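(* Let $d, k \ge 1$ be integers. There exists a constant $C' > 0$, depending on $k$ and $d$, such that for every $\varphi \in C_c^\infty(\mathbb{R}^d)$, $$\int_{\mathbb{R}^d} |\varphi| \, \mathrm{d}\operatorname{cap}_{W^{k,1}} \leq C'\|\varphi\|_{W^{k,1}(\mathbb{R}^d)}.$$
   Context: Functions are real-valued. $W^{k,1}(\mathbb{R}^d)$ is the space of $u \in L^1(\mathbb{R}^d)$ with weak derivatives $D^i u \in L^1(\mathbb{R}^d, \mathbb{R}^{d^i})$ for $i \in \{1,\ldots,k\}$, with norm $\|u\|_{W^{k,1}(\mathbb{R}^d)} := \sum_{i=0}^{k} \|D^i u\|_{L^1(\mathbb{R}^d)}$, $D^0u := u$. The Sobolev capacity of a compact set $K \subset \mathbb{R}^d$ is $$\operatorname{cap}_{W^{k,1}}(K) := \inf\{ \|\varphi\|_{W^{k,1}(\mathbb{R}^d)} : \varphi \in C_c^\infty(\mathbb{R}^d),\ \varphi \ge 0 \text{ in } \mathbb{R}^d,\ \varphi > 1 \text{ on } K\},$$ and for an open set $\omega \subset \mathbb{R}^d$, $\operatorname{cap}_{W^{k,1}}(\omega) := \sup\{\operatorname{cap}_{W^{k,1}}(K) : K \subset \omega \text{ compact}\}$. The Choquet integral is $\int_{\mathbb{R}^d} |\varphi| \, \mathrm{d}\operatorname{cap}_{W^{k,1}} := \int_0^\infty \operatorname{cap}_{W^{k,1}}(\{|\varphi| > t\}) \, \mathrm{d}t$. *)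

(* Defs.v *)
From HB Require Import structures.
From mathcomp Require Import all_boot all_order all_algebra.
From mathcomp Require Import all_classical all_reals all_analysis.
From mathcomp Require Import measurable_realfun.

Set Implicit Arguments.
Unset Strict Implicit.
Unset Printing Implicit Defensive.

Import Order.TTheory GRing.Theory Num.Theory.
Import numFieldNormedType.Exports.

Local Open Scope classical_set_scope.
Local Open Scope ring_scope.

(* The space R^d is 'rV[R]_d. This alias has the same elements and carries the
   Borel sigma-algebra. *)
Definition borel_rV (R : realType) (d : nat) :=
  g_sigma_algebraType (@open 'rV[R]_d).

Section measurable_rV.
Context (R : realType).

Let box (n : nat) (p : {ffun 'I_n -> rat * rat}) : set 'rV[R]_n :=
  [set v | forall j, ratr (p j).1 < v 0 j < ratr (p j).2].

Lemma measurable_fun_rVP disp (T : measurableType disp) (n : nat)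
    (f : T -> borel_rV R n) :
  (forall j, measurable_fun setT
    (fun x => (f x : 'rV[R]_n) 0 j : measurableTypeR R)) ->
  measurable_fun setT f.
Proof.
move=> mf; apply: (@measurability _ _ T (borel_rV R n) _ _ (@open (matrix R 1 n)) erefl) => _ [U oU <-]; rewrite setTI.
have -> : f @^-1` U = \bigcup_(p : {ffun 'I_n -> rat * rat})
    (if `[< box p `<=` U >] then f @^-1` (box p) else set0).
  apply/seteqP; split => x /=; last first.
    by case=> p _; case: asboolP => // + fx; exact.
  move=> Ufx; have /nbhs_ballP[e /= e0 eU] := open_nbhs_nbhs (conj oU Ufx).
  have hq j : exists q : rat * rat,
      (f x : 'rV[R]_n) 0 j - e < ratr q.1 < (f x : 'rV[R]_n) 0 j /\
      (f x : 'rV[R]_n) 0 j < ratr q.2 < (f x : 'rV[R]_n) 0 j + e.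
    have /rat_in_itvoo[q1 q1P] :
        (f x : 'rV[R]_n) 0 j - e < (f x : 'rV[R]_n) 0 j.
      by rewrite ltrBlDr ltrDl.
    have /rat_in_itvoo[q2 q2P] :
        (f x : 'rV[R]_n) 0 j < (f x : 'rV[R]_n) 0 j + e.
      by rewrite ltrDl.
    by exists (q1, q2); move: q1P q2P; rewrite !in_itv.
  have [q qP] := choice hq.
  exists (finfun q) => //; case: asboolP; last first.
    move=> nq; exfalso; apply: nq => v vq; apply: eU; split => // i j.
    rewrite ord1 /ball/=; move: (vq j); rewrite ffunE => /andP[v1 v2].
    have [/andP[a1 _] /andP[_ a2]] := qP j.
    by rewrite ltr_distlC (lt_trans a1 v1) (lt_trans v2 a2).
  move=> _ j; rewrite ffunE.
  by have [/andP[_ ->] /andP[-> _]] := qP j.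
apply: countable_bigcupT_measurable => [|p].
  exact: countableP.
case: asboolP => // _.
rewrite (_ : f @^-1` _ = \bigcap_(j in [set: 'I_n])
    (fun x => (f x : 'rV[R]_n) 0 j : measurableTypeR R) @^-1`
      `]ratr (p j).1, ratr (p j).2[%classic).
  apply: fin_bigcap_measurable => // j _.
  by rewrite -[X in measurable X]setTI; exact: mf.
by apply/seteqP; split => [x + j _|x + j] /=; [|move=> /(_ j I) /=];
  rewrite in_itv//=; exact.
Qed.

Lemma measurable_coord (n : nat) (j : 'I_n) :
  measurable_fun setT
    (fun v : borel_rV R n => (v : 'rV[R]_n) 0 j : measurableTypeR R).
Proof.
apply: (@measurability _ _ _ (measurableTypeR R) _ _ _ (@RGenOpens.measurableE R)).
move=> _ [_ [a [b ->]] <-]; rewrite setTI; apply: sub_sigma_algebra.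
apply: open_comp => [x _|]; first exact: coord_continuous.
exact: interval_open.
Qed.

Definition rV_cons (n : nat) (p : borel_rV R n * measurableTypeR R) :
    borel_rV R n.+1 :=
  (row_mx (const_mx p.2) (p.1 : 'rV[R]_n) : 'rV[R]_(1 + n)).

Lemma measurable_rV_cons (n : nat) : measurable_fun setT (@rV_cons n).
Proof.
apply: measurable_fun_rVP => j; case: (@split_ordP 1 n j) => k ->.
  rewrite [X in measurable_fun _ X](_ : _ = snd); first exact: measurable_snd.
  apply/funext => p.
  exact: etrans (row_mxEl (const_mx p.2) (p.1 : 'rV[R]_n) 0 k) (mxE _ _ _ _).
rewrite [X in measurable_fun _ X]
  (_ : _ = (fun v : borel_rV R n => (v : 'rV[R]_n) 0 k) \o fst).
  exact: (measurableT_comp (measurable_coord k) measurable_fst).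
apply/funext => p.
exact: (row_mxEr (const_mx p.2) (p.1 : 'rV[R]_n) 0 k).
Qed.

End measurable_rV.

Section lebesgue_rVS.
Context (R : realType) (n : nat).
Local Open Scope ereal_scope.
Variable mu : {measure set (borel_rV R n) -> \bar R}.

Definition lebesgue_rVS : set (borel_rV R n.+1) -> \bar R :=
  pushforward (mu \x lebesgue_measure) (@rV_cons R n).

Let lebesgue_rVS0 : lebesgue_rVS set0 = 0.
Proof. by rewrite /lebesgue_rVS /pushforward preimage_set0 measure0. Qed.

Let lebesgue_rVS_ge0 A : 0 <= lebesgue_rVS A.
Proof. by rewrite /lebesgue_rVS /pushforward measure_ge0. Qed.

Let lebesgue_rVS_sigma_additive : semi_sigma_additive lebesgue_rVS.
Proof.
apply: measure_semi_sigma_additive; exact: measurable_rV_cons.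
Qed.

HB.instance Definition _ := isMeasure.Build _ _ _ lebesgue_rVS
  lebesgue_rVS0 lebesgue_rVS_ge0 lebesgue_rVS_sigma_additive.

End lebesgue_rVS.

(* Lebesgue measure on R^d, as a d-fold product of the Lebesgue measure on R. *)
Fixpoint lebesgue_rV (R : realType) (d : nat) :
    {measure set (borel_rV R d) -> \bar R} :=
  match d with
  | 0 => @dirac _ (borel_rV R 0) (0 : 'rV[R]_0) R
  | n.+1 => @lebesgue_rVS R n (lebesgue_rV R n)
  end.

Section sobolev.
Context (R : realType) (d : nat).
Local Notation Rd := 'rV[R]_d.
Local Notation leb := (lebesgue_rV R d).
Implicit Types (u g phi psi : Rd -> R) (s : seq 'I_d).

(* The iterated partial derivative of phi along the coordinates listed in s. *)
Fixpoint partial s phi : Rd -> R :=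
  if s is i :: s' then fun x => 'D_(delta_mx 0 i) (partial s' phi) x else phi.

Definition smooth phi : Prop :=
  forall s, continuous (partial s phi) /\
    forall (i : 'I_d) x, derivable (partial s phi) x (delta_mx 0 i).

(* C_c^oo(R^d) *)
Definition test_function phi : Prop :=
  smooth phi /\ compact (closure [set x | phi x != 0]).

Definition in_L1 u : Prop :=
  leb.-integrable [set: borel_rV R d] (EFin \o (u : borel_rV R d -> R)).

Definition is_weak_partial s u g : Prop :=
  forall psi, test_function psi ->
    \int[leb]_(x in [set: borel_rV R d]) (u x * partial s psi x) =
    (-1) ^+ size s * \int[leb]_(x in [set: borel_rV R d]) (g x * psi x).

(* The weak derivative is unique almost everywhere when it exists; one
   representative is chosen. *)
Definition weak_partial s u : Rd -> R :=
  if s is [::] then u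
  else xget (fun=> 0) [set g | in_L1 g /\ is_weak_partial s u g].

(* W^{k,1}(R^d): the d^i components of D^i u are indexed by i.-tuple 'I_d. *)
Definition sobolev_space (k : nat) : set (Rd -> R) :=
  [set u | in_L1 u /\
    forall (i : nat) (s : i.-tuple 'I_d), (0 < i <= k)%N ->
      exists g, in_L1 g /\ is_weak_partial s u g].

(* The Euclidean norm in R^(d^i) of D^i u at x. *)
Definition weak_D_norm (i : nat) u (x : Rd) : R :=
  Num.sqrt (\sum_(s : i.-tuple 'I_d) (weak_partial s u x) ^+ 2).

(* The W^{k,1} norm, set to +oo outside W^{k,1}(R^d). *)
Definition sobolev_norm (k : nat) u : \bar R :=
  if `[< sobolev_space k u >] then
    (\sum_(i < k.+1)
      \int[leb]_(x in [set: borel_rV R d]) (weak_D_norm i u x)%:E)%E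
  else +oo%E.

Definition cap_compact (k : nat) (K : set Rd) : \bar R :=
  ereal_inf [set sobolev_norm k phi | phi in
    [set phi | [/\ test_function phi, (forall x, 0 <= phi x) &
                   (forall x, K x -> 1 < phi x)]]].

Definition cap_open (k : nat) (omega : set Rd) : \bar R :=
  ereal_sup [set cap_compact k K | K in
    [set K | compact K /\ K `<=` omega]].

(* The sets {|phi| > t} are open for continuous phi. *)
Definition choquet_integral (k : nat) phi : \bar R :=
  (\int[lebesgue_measure]_(t in `[0%R, +oo[) cap_open k [set x | (t < `|phi x|)%R])%E.

End sobolev.

(* Main.v *)
From HB Require Import structures.
Require Import Defs.
From mathcomp Require Import all_boot all_order all_algebra.
From mathcomp Require Import all_classical all_reals all_analysis.
From mathcomp Require Import measurable_realfun.
From mathcomp Require Import zify ring lra.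

(**
It suffices to find dyadic cubes [Q] of side [l(Q) <= 1] and coefficients
[c_Q >= 0] with [|phi| <= sum_Q c_Q 1_Q] and
[sum_Q c_Q l(Q)^(d-k) <= C ||phi||_(W^(k,1)) + epsilon].  Indeed, order the cubes
containing a point from the largest to the smallest; if [|phi(x)| > t], then
exactly one cube [Q] containing [x] satisfies [S_Q <= t < S_Q + c_Q], where [S_Q] is the
sum of the coefficients of the larger cubes.  So [{|phi| > t}] is covered by the cubes active at
height [t], each active on a [t]-interval of length [c_Q], and a cube of side [l <= 1]
has capacity at most [C l^(d-k)] by scaling a bump.

The coefficients come from samples of [phi] on a fine dyadic grid, by induction on [k].
For [k = 1], let [q_Q] be the largest value exceeded by [phi] on a proportion [2^-(d+1)]
of [Q], and let [c_Q] be the increment of the running maximum of [q] at [Q].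
When [c_Q > 0], [phi] is above [q_Q] on a fixed proportion of [Q] and
below the previous maximum on at least half of [Q], so the Poincaré inequality
for the truncation of [phi] between these two levels bounds [c_Q l(Q)^(d-1)]; the
truncations at the cubes containing a given point occupy disjoint intervals of values, so the
bounds add up to the integral of [|grad phi|].  For larger [k], telescope the dyadic averages of [phi]: consecutive ones
differ by at most [C l(Q)] times the average of [|grad phi|] on [Q], and
[|grad phi|] is dominated by the layers of the induction hypothesis.

Riemann sums on the same grids give the divergence theorem for test functions,
which identifies weak and classical derivatives up to the du Bois-Reymond lemma.
*)

Set Implicit Arguments.
Unset Strict Implicit.
Unset Printing Implicit Defensive.

Import Order.TTheory GRing.Theory Num.Theory.
Import numFieldNormedType.Exports.

Local Open Scope ring_scope.

(** * Discrete Poincaré inequality on dyadic grids *)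

Section grid.
Context (R : realFieldType) (d K : nat).
Local Notation grid := {ffun 'I_d -> 'I_K}.
Implicit Types (x y z : grid) (f : grid -> R) (i : 'I_d) (p : nat).

Definition same_block p x y := [forall i, (x i %/ 2 ^ p == y i %/ 2 ^ p)%N].

Definition upd x i (s : 'I_K) : grid := [ffun j => if j == i then s else x j].

(** The successor is cyclic, hence a bijection of the grid. For samples of a function vanishing on
    the faces of the cube, the wrapped difference is still a true forward difference; see
    [corner_shift]. *)
Definition grid_succ i x : grid := upd x i (ordS (x i)).

Definition diff i f x := `|f (grid_succ i x) - f x|.

(** The normalisation is the number of cells of a full block; every block is full when [2 ^ p]
    divides [K]. *)
Definition avg p f x := ((2 ^ p) ^ d)%:R^-1 * \sum_(y | same_block p x y) f y.

Lemma same_block_refl p x : same_block p x x.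
Proof. by apply/forallP. Qed.

Lemma same_block_sym p x y : same_block p x y = same_block p y x.
Proof. by apply: eq_forallb => i; rewrite eq_sym. Qed.

Lemma same_block_eql p x y : same_block p x y -> same_block p x =1 same_block p y.
Proof. by move=> /forallP xy z; apply: eq_forallb => i; rewrite (eqP (xy i)). Qed.

Lemma same_block_le p q x y : (p <= q)%N -> same_block p x y -> same_block q x y.
Proof.
move=> pq /forallP xy; apply/forallP => i.
by rewrite -(subnKC pq) expnD !divnMA (eqP (xy i)).
Qed.

Lemma same_block0 x y : same_block 0 x y = (x == y).
Proof.
apply/forallP/eqP => [xy|-> //]; apply/ffunP => i; apply/val_inj.
by have /eqP := xy i; rewrite !divn1.
Qed.

Lemma card_block1 L (q : 'I_K) : (0 < L)%N -> (L %| K)%N ->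
  #|[pred t : 'I_K | t %/ L == q %/ L]%N| = L.
Proof.
move=> L0 LK; rewrite -sum1_card /=.
rewrite -(big_mkord (fun t => (t %/ L == q %/ L)%N) (fun=> 1%N)).
under eq_bigl => t do rewrite eqn_leq -ltnS ltn_divLR// leq_divRL// andbC.
have qK : ((q %/ L).+1 * L <= K)%N.
  by rewrite -leq_divRL// ltn_divLR ?divnK// mulnC.
move: (q %/ L)%N qK => c qK.
have cL : (c * L <= c.+1 * L)%N by rewrite leq_mul2r leqnSn orbT.
rewrite (big_cat_nat (n := (c * L)%N)) //=; last exact: leq_trans qK.
rewrite big_nat_cond big1 ?add0n; last first.
  by move=> t /andP[/andP[_ ta] /andP[+ _]]; rewrite leqNgt ta.
rewrite (big_cat_nat (n := (c.+1 * L)%N)) //=.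
rewrite [X in (_ + X)%N]big_nat_cond [X in (_ + X)%N]big1 ?addn0; last first.
  by move=> t /andP[/andP[ta _] /andP[_]]; rewrite ltnNge ta.
rewrite big_nat_cond; under eq_bigl => t do rewrite andbb.
by rewrite -big_nat sum_nat_const_nat muln1 mulSn addnK.
Qed.

Lemma card_block p x : (2 ^ p %| K)%N -> #|same_block p x| = ((2 ^ p) ^ d)%N.
Proof.
move=> pK.
transitivity #|family (fun i => [pred t : 'I_K | t %/ 2 ^ p == x i %/ 2 ^ p]%N)|.
  apply: eq_card => y; rewrite [LHS]same_block_sym; exact/forallP/familyP.
rewrite card_family foldrE big_map big_enum /=.
under eq_bigr => i _ do rewrite card_block1 ?expn_gt0//.
by rewrite prod_nat_const card_ord.
Qed.

(** Telescope from [a] to [b]: a block is an interval of indices, so every step starts inside it,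
    and no step wraps around because it starts strictly below [b]. *)
Lemma line_diff (g : 'I_K -> R) L (a b : 'I_K) : (a %/ L)%N = (b %/ L)%N ->
  `|g a - g b| <= \sum_(s : 'I_K | (s %/ L == a %/ L)%N) `|g (ordS s) - g s|.
Proof.
wlog ab : a b / (a <= b)%N => [hw|] eab.
  have [/hw->//|/ltnW ba] := leqP a b.
  by rewrite distrC eab hw.
case: K a b g ab eab => [[]//|K'] a b g ab eab.
pose G s := g (inord s).
have -> : `|g a - g b| = `|\sum_(a <= s < b) (G s.+1 - G s)|.
  by rewrite telescope_sumr// /G !inord_val distrC.
apply: le_trans (ler_norm_sum _ _ _) _.
rewrite (big_nat_widen _ _ K'.+1) ?(ltnW (ltn_ord b))//.
rewrite (big_nat_widenl _ 0)//= big_mkord.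
rewrite [leLHS]big_mkcond [leRHS]big_mkcond /=; apply: ler_sum => s _.
case: ifPn => [/andP[sb as_]|_]; last by case: ifP.
rewrite ifT; last first.
  rewrite eqn_leq [X in _ && X]leq_div2r// andbT eab leq_div2r//; exact: ltnW.
rewrite /G inord_val (_ : inord s.+1 = ordS s)//.
apply/val_inj => /=; rewrite inordK ?modn_small// ltnS.
all: by have := ltn_ord b; lia.
Qed.

(** As [k] runs from 0 to [d], these points form a path from [y] to [z] that changes one coordinate
    at a time. *)
Definition hyb (k : nat) y z : grid := [ffun j : 'I_d => if (j < k)%N then z j else y j].

Lemma hyb_same k p x y z :
  same_block p x y -> same_block p x z -> same_block p x (hyb k y z).
Proof.
move=> /forallP xy /forallP xz; apply/forallP => i; rewrite ffunE.
by case: ifP => _; [exact: xz|exact: xy].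
Qed.

Lemma hyb_invol k y z : hyb k (hyb k y z) (hyb k z y) = y.
Proof. by apply/ffunP => j; rewrite !ffunE; case: (j < k)%N. Qed.

(** The map [(y, z) |-> (hyb k y z, hyb k z y)] is an involution of the pairs in a block, so
    [hyb k y z] can be replaced by [y], and then [z] is free. *)
Lemma sum_hyb k p x (F : grid -> R) : (2 ^ p %| K)%N ->
  \sum_(y | same_block p x y) \sum_(z | same_block p x z) F (hyb k y z) =
  ((2 ^ p) ^ d)%:R * \sum_(y | same_block p x y) F y.
Proof.
move=> pK; rewrite pair_big /=.
pose h (u : grid * grid) := (hyb k u.1 u.2, hyb k u.2 u.1).
have hK : involutive h by case=> y z; rewrite /h /= !hyb_invol.
rewrite (reindex_inj (can_inj hK)) /=.
rewrite (eq_bigl (fun u => same_block p x u.1 && same_block p x u.2)); last first.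
  move=> u; apply/andP/andP => -[h1 h2]; split; try exact: hyb_same.
    by rewrite -(hyb_invol k u.1 u.2); apply: hyb_same.
  by rewrite -(hyb_invol k u.2 u.1); apply: hyb_same.
under eq_bigr do rewrite hyb_invol.
rewrite -(pair_big (same_block p x) (same_block p x) (fun y z => F y)) /=.
under eq_bigr do rewrite sumr_const card_block//.
by rewrite sumrMnl mulr_natl.
Qed.

(** As for [sum_hyb], with the involution [(y, s) |-> (upd y i s, y i)]. *)
Lemma sum_upd i p x (F : grid -> R) : (2 ^ p %| K)%N ->
  \sum_(y | same_block p x y) \sum_(s : 'I_K | (s %/ 2 ^ p == y i %/ 2 ^ p)%N) F (upd y i s)
  = (2 ^ p)%:R * \sum_(y | same_block p x y) F y.
Proof.
move=> pK.
transitivity (\sum_(u : grid * 'I_K | same_block p x u.1 && (u.2 %/ 2 ^ p == u.1 i %/ 2 ^ p)%N)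
   F (upd u.1 i u.2)); first by rewrite pair_big_dep.
pose h (u : grid * 'I_K) := (upd u.1 i u.2, u.1 i).
have updK (y : grid) s : upd (upd y i s) i (y i) = y.
  by apply/ffunP => j; rewrite !ffunE; case: eqP => [->|].
have updi (y : grid) s : upd y i s i = s by rewrite ffunE eqxx.
have hK : involutive h by case=> y z; rewrite /h /= updK updi.
have hsame (u : grid * 'I_K) : same_block p x u.1 && (u.2 %/ 2 ^ p == u.1 i %/ 2 ^ p)%N ->
    same_block p x (h u).1 && ((h u).2 %/ 2 ^ p == (h u).1 i %/ 2 ^ p)%N.
  case: u => y s /= /andP[/forallP xy ys]; rewrite updi eq_sym ys andbT.
  apply/forallP => j; rewrite ffunE; case: (j =P i) => [->|_]; last exact: xy.
  by rewrite (eqP ys); exact: xy.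
rewrite (reindex_inj (can_inj hK)) /=.
rewrite (eq_bigl (fun u : grid * 'I_K => same_block p x u.1 && (u.2 %/ 2 ^ p == u.1 i %/ 2 ^ p)%N)); last first.
  move=> u; apply/idP/idP => hu; last exact: (hsame u hu).
  by have := hsame (h u) hu; rewrite hK.
under eq_bigr do rewrite updK.
rewrite -(pair_big_dep (same_block p x) (fun (y : grid) (s : 'I_K) => (s %/ 2 ^ p == y i %/ 2 ^ p)%N) (fun (y : grid) (_ : 'I_K) => F y)) /=.
under eq_bigr => y _ do rewrite sumr_const card_block1 ?expn_gt0//.
by rewrite sumrMnl mulr_natl.
Qed.

(** Follow the [hyb] path from [y] to [z]. Its step in direction [i] is at most the variation of [f]
    along the line of the block in that direction. Summed over all pairs, each difference is counted
    [(2 ^ p) ^ d] times by [sum_hyb] and [2 ^ p] times by [sum_upd]. *)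
Lemma poincare p x f : (2 ^ p %| K)%N ->
  \sum_(y | same_block p x y) \sum_(z | same_block p x z) `|f y - f z| <=
  ((2 ^ p) ^ d.+1)%:R * \sum_i \sum_(y | same_block p x y) diff i f y.
Proof.
move=> pK.
pose Phi i (u : grid) := \sum_(s : 'I_K | (s %/ 2 ^ p == u i %/ 2 ^ p)%N) diff i f (upd u i s).
have step i (y z : grid) : same_block p x y -> same_block p x z ->
    `|f (hyb i y z) - f (hyb i.+1 y z)| <= Phi i (hyb i y z).
  move=> xy xz; set u := hyb i y z.
  have -> : hyb i.+1 y z = upd u i (z i).
    apply/ffunP => j; rewrite !ffunE ltnS leq_eqVlt; case: (altP (j =P i)) => [->|nij]; first by rewrite eqxx.
    by move: nij; rewrite -val_eqE => /= /negbTE ->.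
  have -> : f u = f (upd u i (u i)).
    by congr (f _); apply/ffunP => j; rewrite [RHS]ffunE; case: (j =P i) => [->|].
  apply: le_trans (line_diff (fun s => f (upd u i s)) _) _; last first.
    apply: ler_sum => s _; rewrite /diff /grid_succ.
    have -> : upd (upd u i s) i (ordS (upd u i s i)) = upd u i (ordS s) => //.
    by apply/ffunP => j; rewrite !ffunE eqxx; case: (j =P i).
  rewrite ffunE ltnn; have := xy; have := xz.
  by move=> /forallP/(_ i)/eqP <- /forallP/(_ i)/eqP <-.
apply: (@le_trans _ _ (\sum_(y | same_block p x y) \sum_(z | same_block p x z)
   \sum_i Phi i (hyb i y z))).
  apply: ler_sum => y xy; apply: ler_sum => z xz.
  have -> : f y - f z = - \sum_(0 <= k < d) (f (hyb k.+1 y z) - f (hyb k y z)).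
    rewrite telescope_sumr// opprB.
    by congr (f _ - f _); apply/ffunP => j; rewrite ffunE ?ltn_ord.
  rewrite normrN big_mkord; apply: le_trans (ler_norm_sum _ _ _) _.
  by apply: ler_sum => i _; rewrite distrC; exact: step.
under eq_bigr do rewrite exchange_big /=.
rewrite exchange_big /= mulr_sumr; apply: ler_sum => i _.
rewrite sum_hyb// /Phi sum_upd// mulrA -natrM.
by rewrite expnSr.
Qed.

End grid.

(** * Layer decompositions *)

Section average.
Context (R : realFieldType) (d K : nat).
Local Notation grid := {ffun 'I_d -> 'I_K}.
Implicit Types (x y z : grid) (f g : grid -> R) (i : 'I_d) (p : nat).

Definition block_const p f := forall x y, same_block p x y -> f x = f y.

Lemma block_card_gt0 p : 0 < ((2 ^ p) ^ d)%:R :> R.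
Proof. by rewrite ltr0n !expn_gt0. Qed.

Lemma avg_const p f : block_const p (avg p f).
Proof.
by move=> x y xy; rewrite /avg (eq_bigl _ _ (same_block_eql xy)).
Qed.

Lemma avg_ge0 p f x : (forall y, 0 <= f y) -> 0 <= avg p f x.
Proof. by move=> f0; rewrite mulr_ge0 ?invr_ge0 ?ler0n ?sumr_ge0. Qed.

Lemma le_avg p f g x : (forall y, same_block p x y -> f y <= g y) -> avg p f x <= avg p g x.
Proof. by move=> fg; rewrite ler_pM2l ?invr_gt0 ?block_card_gt0// ler_sum. Qed.

Lemma avg_sum (I : Type) (r : seq I) (P : pred I) p (F : I -> grid -> R) x :
  avg p (fun y => \sum_(i <- r | P i) F i y) x = \sum_(i <- r | P i) avg p (F i) x.
Proof. by rewrite /avg exchange_big mulr_sumr. Qed.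

Lemma avgZ p (a : R) f x : avg p (fun y => a * f y) x = a * avg p f x.
Proof. by rewrite /avg -mulr_sumr mulrCA. Qed.

Lemma sum_avg p f : (2 ^ p %| K)%N -> \sum_x avg p f x = \sum_x f x.
Proof.
move=> pK; rewrite -mulr_sumr (exchange_big_dep predT)//=.
rewrite (eq_bigr (fun y => ((2 ^ p) ^ d)%:R * f y)) => [|y _]; last first.
  under eq_bigl => x do rewrite same_block_sym.
  by rewrite sumr_const card_block// mulr_natl.
by rewrite -mulr_sumr mulrA mulVf ?mul1r ?gt_eqF ?block_card_gt0.
Qed.

Lemma avg_block_const p f x : (2 ^ p %| K)%N -> block_const p f -> avg p f x = f x.
Proof.
move=> pK fc; rewrite /avg (eq_bigr (fun=> f x)) => [|y xy]; last by rewrite (fc _ _ xy).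
by rewrite sumr_const card_block// -(mulr_natl (f x)) mulrA mulVf ?mul1r ?gt_eqF ?block_card_gt0.
Qed.

Lemma avg_block0 f x : avg 0 f x = f x.
Proof.
by rewrite avg_block_const// ?dvd1n// => u v; rewrite same_block0 => /eqP ->.
Qed.

Lemma block_const_le p q f : (p <= q)%N -> block_const q f -> block_const p f.
Proof. by move=> pq fc x y xy; exact/fc/(same_block_le pq). Qed.

Lemma norm_avg_le p f x : `|avg p f x| <= avg p (fun y => `|f y|) x.
Proof.
rewrite /avg normrM ger0_norm ?invr_ge0 ?ler0n// ler_wpM2l ?invr_ge0 ?ler0n//.
exact: ler_norm_sum.
Qed.

(** The left side is the mean of [f y - f z] over [y] in the child and [z] in the parent. Letting
    [y] range over the whole parent costs the volume ratio [2 ^ d]; then the Poincaré inequality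
    applies on the parent. *)
Lemma avg_diff p f x : (2 ^ p.+1 %| K)%N ->
  `|avg p f x - avg p.+1 f x| <=
  (2 ^ d)%:R * (2 ^ p.+1)%:R * \sum_i avg p.+1 (diff i f) x.
Proof.
move=> pK1.
have pK : (2 ^ p %| K)%N by apply: dvdn_trans pK1; rewrite dvdn_exp2l.
set W := ((2 ^ p) ^ d)%:R : R; set V := ((2 ^ p.+1) ^ d)%:R : R.
have W0 : 0 < W := block_card_gt0 p.
have V0 : 0 < V := block_card_gt0 p.+1.
have VW : V = (2 ^ d)%:R * W by rewrite /V /W -natrM -expnMn expnS.
have -> : avg p f x - avg p.+1 f x = W^-1 * V^-1 *
    \sum_(y | same_block p x y) \sum_(z | same_block p.+1 x z) (f y - f z).
  rewrite (eq_bigr (fun y => V * f y - \sum_(z | same_block p.+1 x z) f z)) => [|y _]; last first.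
    by rewrite sumrB sumr_const card_block// mulr_natl.
  rewrite sumrB -mulr_sumr sumr_const card_block// -(mulr_natl (bigop _ _ _)) -/W /avg -/W -/V.
  by rewrite mulrBr; congr (_ - _); field; rewrite !gt_eqF.
rewrite normrM ger0_norm; last by rewrite mulr_ge0// invr_ge0 ltW.
have -> : (2 ^ d)%:R * (2 ^ p.+1)%:R * \sum_i avg p.+1 (diff i f) x =
    W^-1 * V^-1 * (((2 ^ p.+1) ^ d.+1)%:R *
    \sum_i \sum_(y | same_block p.+1 x y) diff i f y).
  rewrite -mulr_sumr -/V [in RHS]expnSr natrM -/V VW.
  by field; rewrite !gt_eqF// ltr0n expn_gt0.
rewrite ler_pM2l ?mulr_gt0 ?invr_gt0//; apply: le_trans _ (poincare _ _ pK1).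
apply: le_trans (ler_norm_sum _ _ _) _.
apply: (@le_trans _ _ (\sum_(y | same_block p x y) \sum_(z | same_block p.+1 x z) `|f y - f z|)).
  by apply: ler_sum => y _; exact: ler_norm_sum.
rewrite [leLHS]big_mkcond [leRHS]big_mkcond; apply: ler_sum => y _.
case: ifPn => [/(same_block_le (leqnSn p)) ->//|_].
by case: ifP => // _; rewrite sumr_ge0.
Qed.

End average.

Section decomposition.
Context (R : realFieldType) (d A n : nat).
Local Notation K := (A * 2 ^ n)%N.
Local Notation grid := {ffun 'I_d -> 'I_K}.
Implicit Types (x y z : grid) (f g : grid -> R) (i : 'I_d) (p m j : nat).

Lemma dvd_block p : (p <= n)%N -> (2 ^ p %| K)%N.
Proof. by move=> pn; rewrite dvdn_mull// dvdn_exp2l. Qed.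

(* [c m] is constant on the dyadic cubes of side [2^-m]; the weight
   [2^(m k)] turns the sum over cells into the sum over cubes of
   [c_Q * side(Q)^(d-k)], up to the factor [2^(n d)]. *)
Definition layers (k : nat) (f : grid -> R) (C : R) (c : nat -> grid -> R) :=
  [/\ forall m x, 0 <= c m x,
      forall m, block_const (n - m) (c m),
      forall x, `|f x| <= \sum_(m < n.+1) c m x &
      \sum_x \sum_(m < n.+1) 2 ^+ (m * k) * c m x <= C].

Lemma geo_le (a : nat) (b : nat) : (0 < a)%N ->
  \sum_(m < b) 2 ^+ (m * a) <= 2 ^+ (b * a) :> R.
Proof.
move=> a0; elim: b => [|b IH]; first by rewrite big_ord0 mul0n expr0 ler01.
rewrite big_ord_recr /= mulSn exprD.
apply: (@le_trans _ _ (2 * 2 ^+ (b * a))); first by rewrite [X in X * _]mulr2n mulrDl mul1r lerD.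
by rewrite ler_wpM2r ?exprn_ge0// ler_eXnr// ler1n.
Qed.

Lemma geo_half j : (j <= n)%N -> \sum_(m < n | (j <= m)%N) 2 ^- m <= 2 * 2 ^- j :> R.
Proof.
move=> jn; suff H b : (j <= b)%N ->
    \sum_(m < b | (j <= m)%N) 2 ^- m = 2 * 2 ^- j - 2 * 2 ^- b :> R.
  by rewrite H// lerBlDr lerDl mulr_ge0// invr_ge0 exprn_ge0.
elim: b => [|b IH]; first by rewrite leqn0 => /eqP ->; rewrite big_ord0 subrr.
rewrite leq_eqVlt => /orP[/eqP ->|]; last first.
  rewrite ltnS => jb; rewrite big_mkcond big_ord_recr -big_mkcond /= IH// jb.
  by rewrite exprS invfM; move: (2 ^- b) => t; lra.
by rewrite subrr big1// => m; rewrite leqNgt ltn_ord.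
Qed.

(** Write [f] as its coarsest average plus the successive differences of dyadic averages. [avg_diff]
    bounds each difference by the side length times an average of the gradient, which is replaced by
    its layers [G]. *)
Lemma layers_step (k : nat) f (G : nat -> grid -> R) : (0 < k)%N ->
  (forall j x, 0 <= G j x) -> (forall j, block_const (n - j) (G j)) ->
  (forall x, \sum_i 2 ^+ n * diff i f x <= \sum_(j < n.+1) G j x) ->
  exists c, layers k.+1 f (\sum_x `|f x| +
    3 * (2 ^ d)%:R * \sum_x \sum_(j < n.+1) 2 ^+ (j * k) * G j x) c.
Proof.
move=> k0 G0 Gc fG.
pose D : R := (2 ^ d)%:R.
have D0 : 0 <= D by rewrite ler0n.
(* The difference at scale [m] costs [D * 2^-m] times the averages of all the [G j]. Layers finer
   than [m] stay averaged at scale [m]; the coarser ones are moved to their own scale, where a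
   geometric series leaves the factor 2. *)
pose c m x := (if m == 0%N then avg n (fun y => `|f y|) x else 0) +
  D * 2 ^- m * (2 * G m x + \sum_(j < n.+1 | (m < j)%N) avg (n - m) (G j) x).
have i2 m : 0 <= 2 ^- m :> R by rewrite invr_ge0 exprn_ge0.
exists c; split => [m x|m x y xy|x|].
- rewrite addr_ge0//; first by case: ifP => // _; exact: avg_ge0.
  rewrite mulr_ge0// ?mulr_ge0// addr_ge0// ?mulr_ge0// sumr_ge0// => j _.
  exact: avg_ge0.
- rewrite /c; congr (_ + _ * (_ + _)).
  + case: eqP xy => // ->; rewrite subn0 => xy; exact: (avg_const _ xy).
  + by congr (_ * _); exact: Gc.
  + by apply: eq_bigr => j _; exact: avg_const.
- have -> : f x = avg n f x + \sum_(m < n) (avg (n - m.+1) f x - avg (n - m) f x).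
    rewrite -(big_mkord xpredT (fun m => avg (n - m.+1) f x - avg (n - m) f x)).
    by rewrite telescope_sumr// subnn subn0 avg_block0 addrC subrK.
  have step (m : 'I_n) : `|avg (n - m.+1) f x - avg (n - m) f x| <=
      D * 2 ^- m * (\sum_(j < n.+1 | (j <= m)%N) G j x +
                    \sum_(j < n.+1 | (m < j)%N) avg (n - m) (G j) x).
    have mn := ltn_ord m.
    have := @avg_diff R d K (n - m.+1) f x.
    rewrite subnSK// => /(_ (dvd_block (leq_subr _ _))) /le_trans; apply.
    have -> : (2 ^ (n - m))%:R = 2 ^- m * 2 ^+ n :> R.
      have m2 : 2 ^+ m != 0 :> R by rewrite expf_neq0 ?pnatr_eq0.
      by apply: (mulfI m2); rewrite natrX -exprD subnKC ?(ltnW mn)// mulVKf.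
    rewrite -/D !mulrA -[leLHS]mulrA ler_wpM2l ?mulr_ge0//.
    rewrite mulr_sumr; under eq_bigr do rewrite -avgZ.
    rewrite -avg_sum; apply: le_trans (le_avg (fun y _ => fG y)) _.
    rewrite avg_sum (bigID (fun j : 'I_n.+1 => (j <= m)%N)) /= lerD//.
      (* A layer of scale [j <= m] is constant on the block, hence equal to its average. *)
      apply: ler_sum => j jm; rewrite avg_block_const ?dvd_block ?leq_subr//.
      by apply: block_const_le (Gc j); rewrite leq_sub2l.
    by rewrite le_eqVlt; apply/orP; left; apply/eqP; apply: eq_bigl => j; rewrite -ltnNge.
  apply: le_trans (ler_normD _ _) _.
  apply: (@le_trans _ _ (avg n (fun y => `|f y|) x + \sum_(m < n)
     D * 2 ^- m * (\sum_(j < n.+1 | (j <= m)%N) G j x +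
                    \sum_(j < n.+1 | (m < j)%N) avg (n - m) (G j) x))).
    apply: lerD (norm_avg_le _ _ _) _.
    by apply: le_trans (ler_norm_sum _ _ _) _; apply: ler_sum.
  rewrite /c big_split /= lerD//.
    by rewrite big_ord_recl /= big1 ?addr0.
  under eq_bigr do rewrite mulrDr.
  under [leRHS]eq_bigr do rewrite mulrDr.
  rewrite !big_split /= lerD//; last first.
    rewrite [leRHS]big_ord_recr /= lerDl mulr_ge0 ?mulr_ge0// sumr_ge0// => j _.
    exact: avg_ge0.
  under eq_bigr do rewrite mulr_sumr.
  rewrite (exchange_big_dep xpredT) //=; apply: ler_sum => j _.
  rewrite -mulr_suml -mulr_sumr -!mulrA ler_wpM2l// mulrA ler_wpM2r//.
  by rewrite mulrC geo_half// -ltnS.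
- under eq_bigr do under eq_bigr do rewrite mulrDr.
  under eq_bigr do rewrite big_split.
  rewrite big_split /= lerD//.
    rewrite -(sum_avg (fun y => `|f y|) (dvd_block (leqnn n))); apply: ler_sum => x _.
    by rewrite big_ord_recl /= mul0n expr0 mul1r big1 ?addr0// => i _; rewrite mulr0.
  (* The side length [2^-m] absorbs one factor of the weight, so that the cost in order [k + 1]
     becomes a cost in order [k]. *)
  have pw m : 2 ^+ (m * k.+1) * (D * 2 ^- m) = D * 2 ^+ (m * k) :> R.
    by rewrite mulnS exprD mulrCA mulrAC mulfV ?mul1r ?expf_neq0 ?pnatr_eq0.
  rewrite -/D; set S := \sum_x \sum_(j < n.+1) 2 ^+ (j * k) * G j x.
  pose T (m : nat) x := \sum_(j < n.+1 | (m < j)%N) avg (n - m) (G j) x.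
  rewrite (eq_bigr (fun x => D * (2 * (\sum_(j < n.+1) 2 ^+ (j * k) * G j x) +
     \sum_(m < n.+1) 2 ^+ (m * k) * T m x))) => [|x _]; last first.
    rewrite mulr_sumr -big_split mulr_sumr; apply: eq_bigr => m _ /=.
    by rewrite mulrA pw -/(T m x); ring.
  rewrite -mulr_sumr big_split -mulr_sumr -/S /= mulrAC -mulrA [leRHS]mulrCA mulrA.
  rewrite [leRHS]mulrC ler_wpM2l//.
  (* Averaging preserves sums, so layer [j] is charged the sum of [2^(m k)] over [m < j], at most
     [2^(j k)] since [k > 0]. With the two copies of [S] already present, this gives the constant
     3. *)
  suff: \sum_x \sum_(m < n.+1) 2 ^+ (m * k) * T m x <= S by move=> ?; lra.
  rewrite exchange_big /=.
  rewrite (eq_bigr (fun m : 'I_n.+1 => \sum_(j < n.+1 | (m < j)%N)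
      2 ^+ (m * k) * \sum_x G j x)) => [|m _]; last first.
    rewrite -!mulr_sumr exchange_big /=; congr (_ * _); apply: eq_bigr => j _.
    exact: (sum_avg _ (dvd_block (leq_subr m n))).
  rewrite (exchange_big_dep xpredT) //= /S exchange_big /=; apply: ler_sum => j _.
  rewrite -mulr_suml -mulr_sumr ler_wpM2r ?sumr_ge0//.
  rewrite (le_trans _ (geo_le _ k0))//.
  rewrite -(big_mkord (fun m => (m < j)%N) (fun m => 2 ^+ (m * k))).
  rewrite -(big_mkord xpredT (fun m => 2 ^+ (m * k))) (big_nat_widen 0 j n.+1)//.
  exact: ltnW.
Qed.

End decomposition.

(** * The first-order case *)

Section clamp.
Context (R : realFieldType).
Implicit Types a b s t : R.

Definition clamp a b s := Num.max a (Num.min b s).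

Lemma clamp_cat (m a b s : R) : m <= a -> a <= b ->
  clamp m b s - clamp m a s = clamp a b s - a.
Proof.
move=> ma ab; rewrite /clamp.
by case: (leP b s) => ?; case: (leP a s) => ?; case: (leP m a) => ?; case: (leP m b) => ?; case: (leP m s) => ?; case: (leP a b) => ?; lra.
Qed.

Lemma ler_clamp a b : {homo clamp a b : s t / s <= t}.
Proof.
by move=> s t st; rewrite /clamp; case: (leP b s) => ?; case: (leP b t) => ?; case: (leP a b) => ?; case: (leP a s) => ?; case: (leP a t) => ?; lra.
Qed.

Lemma clamp_dist a b s t : a <= b -> `|clamp a b s - clamp a b t| <= `|s - t|.
Proof.
wlog st : s t / s <= t => [hw ab|ab].
  by have [/hw->//|/ltW ts] := leP s t; rewrite distrC (distrC s) hw.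
rewrite ler0_norm ?subr_le0 ?ler_clamp// ler0_norm ?subr_le0//.
by rewrite /clamp; case: (leP b s) => ?; case: (leP b t) => ?; case: (leP a b) => ?; case: (leP a s) => ?; case: (leP a t) => ?; lra.
Qed.

(** Truncation is monotone, so all the increments have the same sign, and truncations to consecutive
    intervals add up to the truncation to their union. *)
Lemma sum_clamp (M : nat -> R) n s t : {homo M : i j / (i <= j)%N >-> i <= j} ->
  \sum_(m < n) `|clamp (M m) (M m.+1) s - clamp (M m) (M m.+1) t| <= `|s - t|.
Proof.
move=> Mh; apply: le_trans (clamp_dist s t (Mh 0%N n isT)).
wlog st : s t / s <= t => [hw|].
  have [/hw//|/ltW ts] := leP s t; rewrite distrC.
  by under eq_bigr do rewrite distrC; exact: hw.
have cl a b : `|clamp a b s - clamp a b t| = clamp a b t - clamp a b s.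
  by rewrite distrC ger0_norm// subr_ge0 ler_clamp.
rewrite cl; under eq_bigr do rewrite cl.
elim: n => [|n IH]; first by rewrite big_ord0 subr_ge0 ler_clamp.
rewrite big_ord_recr /=.
have := clamp_cat t (Mh 0%N n isT) (Mh n n.+1 (leqnSn n)).
have := clamp_cat s (Mh 0%N n isT) (Mh n n.+1 (leqnSn n)).
lra.
Qed.

End clamp.

(** * Quantiles on dyadic blocks *)

Section quantile.
Context (R : realFieldType) (d K : nat).
Local Notation grid := {ffun 'I_d -> 'I_K}.
Implicit Types (x y z : grid) (f g : grid -> R) (i : 'I_d) (p : nat).

Definition often p x (P : pred grid) :=
  ((2 ^ p) ^ d <= 2 ^ d.+1 * #|[pred z | same_block p x z && P z]|)%N.

(* With the proportion [2^-(d+1)], a block whose parent is seldom above a level is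
   itself below that level on at least half of its cells. *)
Definition quantile p f x :=
  \big[Num.max/0]_(y | same_block p x y && often p x (fun z => f y <= f z)) f y.

Lemma quantile_ge0 p f x : 0 <= quantile p f x.
Proof. exact: bigmax_ge_id. Qed.

Lemma quantile_often p f x : 0 < quantile p f x ->
  often p x (fun z => quantile p f x <= f z).
Proof.
rewrite /quantile; elim/big_ind: _ => [|a b Ha Hb|y /andP[_ //]]; first by rewrite ltxx.
by have [ab /Hb|ba /Ha] := leP a b.
Qed.

(** Otherwise the smallest value of [f] strictly above the quantile would itself be reached often,
    and would be one of the values whose maximum is the quantile. *)
Lemma quantile_seldom p f x : ~~ often p x (fun z => quantile p f x < f z).
Proof.
apply/negP => h.
have [z0 /andP[xz0 fz0]] : exists z, same_block p x z && (quantile p f x < f z).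
  move: h; rewrite /often; set S := [pred z | _]; have [->|/card_gt0P[z zS] _] := posnP #|S|.
    by rewrite muln0 leqn0 expn_eq0 expn_eq0.
  by exists z.
pose P z := same_block p x z && (quantile p f x < f z).
have Pz0 : P z0 by rewrite /P xz0.
case: (arg_minP f Pz0) => y /andP[xy fy] ymin.
have : f y <= quantile p f x.
  apply: (le_bigmax_cond 0 f); rewrite xy /=.
  apply: leq_trans h _; rewrite leq_mul2l; apply/orP; right.
  by apply: subset_leq_card; apply/fintype.subsetP => z /andP[xz fz]; rewrite inE xz ymin ?/P ?xz.
by rewrite leNgt fy.
Qed.

Lemma quantile_const p f : block_const p (quantile p f).
Proof.
move=> x y xy; apply: eq_bigl => z; rewrite (same_block_eql xy).
rewrite /often (eq_card (B := [pred z0 | same_block p y z0 && (f z <= f z0)]))// => u.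
by rewrite !inE (same_block_eql xy).
Qed.

Lemma quantile0_ge f x : f x <= quantile 0 f x.
Proof.
apply: (le_bigmax_cond 0 f); rewrite same_block_refl /often.
rewrite expn0 exp1n muln_gt0 expn_gt0 /=; apply/card_gt0P; exists x.
by rewrite inE same_block_refl lexx.
Qed.

(** Markov's inequality. *)
Lemma quantile_le_avg p f x : quantile p f x <= (2 ^ d.+1)%:R * avg p (fun y => `|f y|) x.
Proof.
have [q0|q0] := leP (quantile p f x) 0.
  by apply: le_trans q0 _; rewrite mulr_ge0 ?ler0n// avg_ge0.
rewrite /avg mulrCA ler_pdivlMl ?block_card_gt0//.
have /= := quantile_often q0; rewrite /often -(ler_nat R) natrM => h.
apply: (@le_trans _ _ (((2 ^ d.+1)%:R * #|[pred z | same_block p x z && (quantile p f x <= f z)]|%:R) * quantile p f x)).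
  by rewrite ler_wpM2r// ltW.
rewrite -mulrA ler_wpM2l ?ler0n// mulr_natl -sumr_const.
rewrite [leLHS]big_mkcond [leRHS]big_mkcond; apply: ler_sum => y _.
rewrite inE; case: ifPn => [/andP[-> h1]|_]; last by case: ifP.
by rewrite (le_trans h1)// ler_norm.
Qed.

(* A relative isoperimetric inequality, from Poincaré applied to the truncation of
   [f] to the interval from [a] to [b]. *)
Lemma jump_le p f x a b : (2 ^ p %| K)%N -> a <= b ->
  often p x (fun z => b <= f z) ->
  ((2 ^ p) ^ d <= 2 * #|[pred z | same_block p x z && (f z <= a)%R]|)%N ->
  b - a <= (2 ^ d.+2)%:R * (2 ^ p)%:R * \sum_i avg p (diff i (clamp a b \o f)) x.
Proof.
move=> pK ab hb ha.
set W := ((2 ^ p) ^ d)%:R : R.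
have W0 : 0 < W := block_card_gt0 R d p.
set u := clamp a b \o f.
set S1 := [pred z | same_block p x z && (b <= f z)] in hb *.
set S2 := [pred z | same_block p x z && (f z <= a)] in ha *.
(* Each pair of a cell above [b] and a cell below [a] contributes exactly [b - a] to the double
   sum. *)
have e1 : (b - a) * #|S1|%:R * #|S2|%:R <=
    \sum_(y | same_block p x y) \sum_(z | same_block p x z) `|u y - u z|.
  apply: (@le_trans _ _ (\sum_(y in S1) \sum_(z in S2) (b - a))).
    by rewrite sumr_const sumr_const -(mulr_natr ((b - a) *+ #|S2|)) -(mulr_natr (b - a) #|S2|) mulrAC.
  rewrite [leLHS]big_mkcond [leRHS]big_mkcond; apply: ler_sum => y _.
  rewrite inE; case: ifPn => [/andP[-> h1]|_]; last by case: ifP => // _; rewrite sumr_ge0.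
  rewrite [leLHS]big_mkcond [leRHS]big_mkcond; apply: ler_sum => z _.
  rewrite inE; case: ifPn => [/andP[-> h2]|_]; last by case: ifP.
  rewrite /u /= /clamp (min_idPl h1) (max_idPr ab).
  rewrite (min_idPr (le_trans h2 ab)) (max_idPl h2) ger0_norm ?subr_ge0//.
have := le_trans e1 (poincare x u pK).
rewrite expnSr natrM -/W => e2.
have hb' : W <= (2 ^ d.+1)%:R * #|S1|%:R by rewrite -natrM ler_nat.
have ha' : W <= 2 * #|S2|%:R by rewrite -natrM ler_nat.
(* The proportions of [S1] and [S2] are at least [2^-(d+1)] and [1/2]; the inverse of their product
   is the constant. *)
have e3 : (b - a) * (W * W) <= (2 ^ d.+2)%:R * ((b - a) * #|S1|%:R * #|S2|%:R).
  have -> : (2 ^ d.+2)%:R * ((b - a) * #|S1|%:R * #|S2|%:R) =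
     (b - a) * (((2 ^ d.+1)%:R * #|S1|%:R) * (2 * #|S2|%:R)).
    by rewrite [X in X * _ = _](_ : _ = 2 * (2 ^ d.+1)%:R); [ring|rewrite -natrM -expnS].
  by rewrite ler_wpM2l ?subr_ge0// ler_pM// ltW.
rewrite -(ler_pM2r (mulr_gt0 W0 W0)); apply: le_trans e3 _.
rewrite /avg -mulr_sumr -/W.
rewrite [leRHS](_ : _ = (2 ^ d.+2)%:R * (W * (2 ^ p)%:R *
  \sum_i \sum_(y | same_block p x y) diff i u y)); last first.
  by field; rewrite gt_eqF.
by rewrite ler_wpM2l ?ler0n.
Qed.

End quantile.

(** * Increments of the running maximum as layer coefficients *)

Section base.
Context (R : realFieldType) (d A n : nat).
Local Notation K := (A * 2 ^ n)%N.
Local Notation grid := {ffun 'I_d -> 'I_K}.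
Implicit Types (x y z : grid) (f g : grid -> R) (i : 'I_d) (p m j : nat).

(** The scale descends from blocks of level [n] to single cells. Monotonicity in [m] makes the
    increments nonnegative and the intervals of values between consecutive maxima disjoint. *)
Fixpoint runmax f m x := if m is m'.+1 then
  Num.max (runmax f m' x) (quantile (n - m) f x) else quantile n f x.

Lemma runmax_homo f x : {homo runmax f ^~ x : i j / (i <= j)%N >-> i <= j}.
Proof.
apply: homo_leq => [//|i j k|m]; first exact: le_trans.
by rewrite /= le_max lexx.
Qed.

Lemma runmax_const f m : block_const (n - m) (runmax f m).
Proof.
elim: m => [|m IH] x y xy /=; first by move: xy; rewrite subn0; exact: quantile_const.
rewrite (quantile_const f xy) (IH x y)//; apply: same_block_le xy.
by rewrite leq_sub2l.
Qed.

Lemma runmax_ge f m x : quantile (n - m) f x <= runmax f m x.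
Proof. by case: m => [|m]; rewrite /= ?subn0// le_max lexx orbT. Qed.

Lemma runmax_ge0 f m x : 0 <= runmax f m x.
Proof. exact: le_trans (quantile_ge0 _ _ _) (runmax_ge _ _ _). Qed.

(** If the maximum increases, its new value is the quantile of the current block, hence reached
    often there, while the quantile of the parent is at most the old value. So [jump_le] applies
    between the two values. *)
Lemma runmax_jump f m x : (m < n)%N ->
  2 ^+ m.+1 * (runmax f m.+1 x - runmax f m x) <=
  (2 ^ d.+2)%:R * \sum_i 2 ^+ n *
    avg (n - m.+1) (diff i (clamp (runmax f m x) (runmax f m.+1 x) \o f)) x.
Proof.
move=> mn.
have [h|h] := leP (runmax f m.+1 x) (runmax f m x).
  apply: (@le_trans _ _ 0).
    by rewrite mulr_ge0_le0 ?exprn_ge0// subr_le0.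
  by rewrite mulr_ge0 ?ler0n ?sumr_ge0// => i _; rewrite mulr_ge0 ?exprn_ge0//; apply: avg_ge0 => y; exact: normr_ge0.
have e : runmax f m.+1 x = quantile (n - m.+1) f x.
  by move: h => /=; case: (leP (runmax f m x)) => // _; rewrite ltxx.
set p := (n - m.+1)%N in e *.
have pm : (n - m)%N = p.+1 by rewrite /p subnSK.
have := @jump_le R d K p f x (runmax f m x) (runmax f m.+1 x)
  (dvd_block _ (leq_subr _ _)) (ltW h).
have -> : often p x (fun z => runmax f m.+1 x <= f z).
  by rewrite e; apply: quantile_often; rewrite -e (le_lt_trans _ h)// runmax_ge0.
move=> /(_ isT) jump.
rewrite (eq_bigr (fun i => 2 ^+ n * avg p (diff i (clamp (runmax f m x) (runmax f m.+1 x) \o f)) x))//.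
rewrite -mulr_sumr.
have -> : 2 ^+ n = 2 ^+ m.+1 * (2 ^ p)%:R :> R.
  by rewrite natrX -exprD /p subnKC.
rewrite -[X in _ <= _ * X]mulrA [leRHS]mulrCA ler_pM2l ?exprn_gt0// mulrA.
apply: jump.
(* Fewer than [2^-(d+1)] of the cells of the parent are above the old maximum. The parent has [2^d]
   times as many cells as the block, so these are fewer than half the cells of the block. *)
have := quantile_seldom p.+1 f x.
rewrite /often -ltnNge.
rewrite (expnS 2 p) expnMn (expnS 2 d) => lt.
have := cardID (fun z => f z <= runmax f m x) (same_block p x).
rewrite (card_block x (dvd_block A (leq_subr m.+1 n))).
have -> : #|[predD same_block p x & (fun z => f z <= runmax f m x)]| =
    #|[pred z | same_block p x z && (runmax f m x < f z)%R]|.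
  by apply: eq_card => z; rewrite !inE /in_mem /= -ltNge andbC.
have -> : #|[predI same_block p x & (fun z => f z <= runmax f m x)]| =
    #|[pred z | same_block p x z && (f z <= runmax f m x)%R]|.
  exact: eq_card.
have : (#|[pred z | same_block p x z && (runmax f m x < f z)%R]| <=
   #|[pred z | same_block p.+1 x z && (quantile p.+1 f x < f z)%R]|)%N.
  apply: subset_leq_card; apply/fintype.subsetP => z; rewrite !inE => /andP[xz fz].
  rewrite (same_block_le (leqnSn p))//= (le_lt_trans _ fz)// -pm.
  exact: runmax_ge.
have : (0 < 2 ^ d)%N by rewrite expn_gt0.
move: lt.
set W := ((2 ^ p) ^ d)%N; set D := (2 ^ d)%N; set c1 := #|_|; set c2 := #|_|; set c3 := #|_|; nia.
Qed.

(** The coefficients are the increments of [runmax]. Layer 0 is paid by Markov's inequality and the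
    later ones by [runmax_jump]; at each cell the truncations are to consecutive intervals, so
    [sum_clamp] reduces their total to [diff i f]. *)
Lemma layers_pos f : exists c, [/\ forall m x, 0 <= c m x,
      forall m, block_const (n - m) (c m),
      forall x, f x <= \sum_(m < n.+1) c m x &
      \sum_x \sum_(m < n.+1) 2 ^+ m * c m x <=
      (2 ^ d.+2)%:R * (\sum_x `|f x| + \sum_x \sum_i 2 ^+ n * diff i f x)].
Proof.
pose c m x := if m is m'.+1 then runmax f m x - runmax f m' x else runmax f 0 x.
exists c; split => [[|m] x|m x y xy|x|].
- exact: runmax_ge0.
- by rewrite subr_ge0 runmax_homo.
- case: m xy => [|m] xy; first exact: runmax_const.
  rewrite /c (runmax_const f xy) (@runmax_const f m x y)//.
  by apply: same_block_le xy; rewrite leq_sub2l.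
- apply: le_trans (quantile0_ge f x) _.
  have := runmax_ge f n x; rewrite subnn => /le_trans; apply.
  rewrite big_ord_recl /= -(big_mkord xpredT (fun m => runmax f m.+1 x - runmax f m x)).
  by rewrite telescope_sumr// addrC subrK.
- under eq_bigr do rewrite big_ord_recl /= expr0 mul1r.
  rewrite big_split mulrDr /= lerD//.
    apply: (@le_trans _ _ (\sum_x (2 ^ d.+1)%:R * avg n (fun y => `|f y|) x)).
      by apply: ler_sum => x _; exact: quantile_le_avg.
    rewrite -mulr_sumr sum_avg ?dvd_block// ler_wpM2r ?sumr_ge0//.
    by rewrite ler_nat leq_exp2l.
  rewrite mulr_sumr.
  (* The truncation levels are read at the averaged cell [y] instead of [x]. Both are in the same
     block, where the levels are constant, and the sum over [m] can then be taken at fixed [y]. *)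
  pose H (m : nat) i y := `|clamp (runmax f m y) (runmax f m.+1 y) (f (grid_succ i y)) -
    clamp (runmax f m y) (runmax f m.+1 y) (f y)|.
  apply: (@le_trans _ _ (\sum_x \sum_(m < n) (2 ^ d.+2)%:R *
      \sum_i 2 ^+ n * avg (n - m.+1) (H m i) x)).
    apply: ler_sum => x _; apply: ler_sum => m _.
    apply: le_trans (runmax_jump f x (ltn_ord m)) _.
    rewrite ler_wpM2l ?ler0n//; apply: ler_sum => i _; rewrite ler_wpM2l ?exprn_ge0//.
    apply: le_avg => y xy; rewrite /H -(runmax_const f xy) -(@runmax_const f m x y)//.
    by apply: same_block_le xy; rewrite leq_sub2l.
  under eq_bigr do rewrite -mulr_sumr.
  rewrite -!mulr_sumr ler_wpM2l ?ler0n//.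
  rewrite exchange_big /=.
  under eq_bigr do rewrite exchange_big /=.
  under eq_bigr => m _ do under eq_bigr => i _ do
    rewrite -mulr_sumr (sum_avg _ (dvd_block _ (leq_subr _ _))).
  rewrite exchange_big /= [leRHS]exchange_big /=; apply: ler_sum => i _.
  rewrite -!mulr_sumr ler_wpM2l ?exprn_ge0// exchange_big /=; apply: ler_sum => y _.
  exact: (sum_clamp n (f (grid_succ i y)) (f y) (runmax_homo f y)).
Qed.

(** [layers_pos] dominates [f] only from above; adding the layers of [- f] controls the absolute
    value and doubles the constant. *)
Lemma layers_base f : exists c, layers 1 f ((2 ^ d.+3)%:R *
  (\sum_x `|f x| + \sum_x \sum_i 2 ^+ n * diff i f x)) c.
Proof.
have [c [c0 cc cf cs]] := layers_pos f.
have [c' [c0' cc' cf' cs']] := layers_pos (fun x => - f x).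
exists (fun m x => c m x + c' m x); split => [m x|m x y xy|x|].
- by rewrite addr_ge0.
- by rewrite (cc _ _ _ xy) (cc' _ _ _ xy).
- rewrite big_split /= ler_norml; apply/andP; split.
    rewrite lerNl (le_trans (cf' x))// lerDr sumr_ge0//.
  by rewrite (le_trans (cf x))// lerDl sumr_ge0.
- under eq_bigr do under eq_bigr do rewrite muln1 mulrDr.
  under eq_bigr do rewrite big_split.
  rewrite big_split /=; apply: le_trans (lerD cs cs') _.
  have -> : (2 ^ d.+3)%:R = 2 * (2 ^ d.+2)%:R :> R by rewrite -natrM -expnS.
  have -> : \sum_x \sum_i 2 ^+ n * diff i (fun x => - f x) x = \sum_x \sum_i 2 ^+ n * diff i f x.
    apply: eq_bigr => x _; apply: eq_bigr => i _; congr (_ * _).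
    by rewrite /diff opprK addrC distrC.
  under [X in _ + _ * (X + _)]eq_bigr do rewrite normrN.
  by rewrite le_eqVlt; apply/orP; left; apply/eqP; ring.
Qed.

End base.

Local Open Scope classical_set_scope.
Local Open Scope ring_scope.

(** * Boxes and compactly supported continuous functions *)

Section box.
Context (R : realType).

(** Half-open, so that the dyadic cells are pairwise disjoint. *)
Definition box (d : nat) (a b : 'I_d -> R) : set 'rV[R]_d :=
  [set v | forall j, a j <= v 0 j < b j].

Lemma measurable_box d (a b : 'I_d -> R) : measurable (box a b : set (borel_rV R d)).
Proof.
rewrite (_ : box a b = \bigcap_(j in [set: 'I_d])
    (fun v : borel_rV R d => (v : 'rV[R]_d) 0 j : measurableTypeR R) @^-1`
      `[a j, b j[%classic).
  apply: fin_bigcap_measurable => // j _.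
  by rewrite -[X in measurable X]setTI; exact: (measurable_coord j).
by apply/seteqP; split => [v + j _|v + j] /=; [|move=> /(_ j I) /=];
  rewrite in_itv//=; exact.
Qed.

Lemma measurable_open_box d (a b : 'I_d -> R) :
  measurable ([set v | forall j, a j < v 0 j < b j] : set (borel_rV R d)).
Proof.
rewrite [X in measurable X](_ : _ = \bigcap_(j in [set: 'I_d])
    (fun v : borel_rV R d => (v : 'rV[R]_d) 0 j : measurableTypeR R) @^-1`
      `]a j, b j[%classic).
  apply: fin_bigcap_measurable => // j _.
  by rewrite -[X in measurable X]setTI; exact: (measurable_coord j).
by apply/seteqP; split => [v + j _|v + j] /=; [|move=> /(_ j I) /=];
  rewrite in_itv//=; exact.
Qed.

Lemma rV_cons0 d (p : borel_rV R d * measurableTypeR R) :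
  (rV_cons p : 'rV[R]_d.+1) 0 ord0 = p.2.
Proof. by rewrite /rV_cons mxE; case: splitP => // k _; rewrite mxE. Qed.

Lemma rV_consS d (p : borel_rV R d * measurableTypeR R) (k : 'I_d) :
  (rV_cons p : 'rV[R]_d.+1) 0 (lift ord0 k) = (p.1 : 'rV[R]_d) 0 k.
Proof.
rewrite /rV_cons mxE; case: splitP => [i|i]; first by rewrite ord1.
by move=> /= /eqP; rewrite /bump /= eqn_add2l => /eqP/val_inj ->.
Qed.

(** Induction on the dimension: pulled back by [rV_cons], a box is the product of a box of lower
    dimension and an interval. *)
Lemma lebesgue_box d (a b : 'I_d -> R) : (forall j, a j <= b j) ->
  lebesgue_rV R d (box a b) = (\prod_j (b j - a j))%:E.
Proof.
elim: d a b => [|d IH] a b ab.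
  rewrite big_ord0 /= /dirac /= indicE mem_set//.
  by case.
rewrite /= /lebesgue_rVS /pushforward.
rewrite (_ : _ @^-1` _ = (box (a \o lift ord0) (b \o lift ord0) : set (borel_rV R d))
   `*` (`[a ord0, b ord0[%classic : set (measurableTypeR R))); last first.
  apply/seteqP; split => [[v t] /= vt|[v t] /= [vb tb] j].
    split => [j|]; first by have := vt (lift ord0 j); rewrite rV_consS.
    by have := vt ord0; rewrite rV_cons0 /= in_itv.
  case: (unliftP ord0 j) => [k ->|->]; first by rewrite rV_consS; exact: vb.
  by rewrite rV_cons0; move: tb; rewrite in_itv.
have -> : (lebesgue_rV R d \x lebesgue_measure)%E
     ((box (a \o lift ord0) (b \o lift ord0) : set (borel_rV R d))
   `*` (`[a ord0, b ord0[%classic : set (measurableTypeR R))) =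
   (lebesgue_rV R d (box (a \o lift ord0) (b \o lift ord0)) *
    lebesgue_measure (`[a ord0, b ord0[%classic : set (measurableTypeR R)))%E.
  by apply: product_measure1E; [exact: measurable_box|exact: measurable_itv].
rewrite IH; last by move=> j; exact: ab.
rewrite lebesgue_measure_itv /= lte_fin big_ord_recl /=.
case: ltP => [_|ba]; first by rewrite -EFinD -EFinM mulrC.
have -> : a ord0 = b ord0 by apply/le_anti; rewrite ab ba.
by rewrite subrr mul0r mule0.
Qed.

Lemma continuous_measurable_rV d (f : 'rV[R]_d -> R) : continuous f ->
  measurable_fun setT (f : borel_rV R d -> measurableTypeR R).
Proof.
move=> fc.
apply: (@measurability _ _ _ (measurableTypeR R) _ _ _ (@RGenOpens.measurableE R)).
move=> _ [_ [a [b ->]] <-]; rewrite setTI; apply: sub_sigma_algebra.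
apply: open_comp => [x _|]; first exact: fc.
exact: interval_open.
Qed.

(** The faces of the cube are included in the set where [f] vanishes: the cyclic successor of the
    grid identifies opposite faces. *)
Definition supp_in (d M : nat) (f : 'rV[R]_d -> R) :=
  forall v : 'rV[R]_d, (exists j, M%:R <= `|v 0 j|) -> f v = 0.

Lemma compact_cube d (M : R) : compact [set v : 'rV[R]_d | forall j, `|v 0 j| <= M].
Proof.
have := @rV_compact R d (fun=> `[- M, M]%classic) (fun=> @segment_compact _ _ _).
congr (compact _); apply/seteqP; split => v /= h j; have := h j;
  by rewrite in_itv /= ler_norml.
Qed.

Lemma supp_in_bounded d M (f : 'rV[R]_d -> R) : continuous f -> supp_in M f ->
  exists2 C, 0 <= C & forall v, `|f v| <= C.
Proof.
move=> fc fM.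
have [||c _ cmax] := @EVT_max_rV R d (fun v => `|f v|) _ _ (@compact_cube d M%:R) _.
- by exists 0 => j /=; rewrite mxE normr0.
- apply: continuous_subspaceT => v; apply: (@continuous_comp _ _ _ f (@Num.norm R R)); [exact: fc|exact: norm_continuous].
exists `|f c| => // v.
have [h|h] := pselect (forall j, `|v 0 j| <= M%:R); first by apply: cmax; rewrite inE.
rewrite fM ?normr0//; move/existsNP: h => [j /negP]; rewrite -ltNge => /ltW ?.
by exists j.
Qed.

Lemma normr_rVP d (v : 'rV[R]_d) (e : R) : 0 < e ->
  (forall j, `|v 0 j| < e) -> `|v| < e.
Proof.
move=> e0 h; rewrite [ltLHS]/Num.norm /= mx_normrE; apply/bigmax_ltP; split => // -[i j] _ /=.
by rewrite ord1.
Qed.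

(** Uniform continuity from compactness of the closed cube. At least one of the two points may be
    assumed to lie in it, since otherwise both values vanish. *)
Lemma supp_in_unif d M (f : 'rV[R]_d -> R) : continuous f -> supp_in M f ->
  forall e : R, 0 < e -> exists2 r : R, 0 < r &
    forall v w : 'rV[R]_d, (forall j, `|v 0 j - w 0 j| < r) -> `|f v - f w| <= e.
Proof.
move=> fc fM e e0.
have /compact_near_coveringP cpt := @compact_cube d (M%:R : R).
have : \forall r \near (0 : R)^'+, [set v : 'rV[R]_d | forall j, `|v 0 j| <= M%:R] `<=`
    (fun v => forall w : 'rV[R]_d, (forall j, `|v 0 j - w 0 j| < r) -> `|f v - f w| <= e).
  apply: cpt => v _.
  have /cvgrPdist_lt/(_ (e / 2)) := fc v.
  rewrite divr_gt0// => /(_ isT) /nbhs_ballP[s /= s0 sv].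
  exists (ball v (s / 2) : set 'rV[R]_d, [set r : R | r < s / 2]); rewrite /=.
    split; first by apply: nbhsx_ballx; rewrite divr_gt0.
    by near=> r; near: r; apply: nbhs_right_lt; rewrite divr_gt0.
  move=> [u r] /= [vu rs] w uw.
  have uw' : ball u (s / 2) w.
    rewrite -ball_normE /=; apply: normr_rVP; first by rewrite divr_gt0.
    by move=> j; rewrite !mxE (lt_trans (uw j)).
  have h1 : `|f v - f u| < e / 2.
    by apply: sv; apply: le_ball vu; rewrite ler_pdivrMr// ler_pMr// ler1n.
  have h2 : `|f v - f w| < e / 2 by exact: sv (ball_split vu uw').
  rewrite -(subrKA (f v)); apply: le_trans (ler_normD _ _) _.
  rewrite (splitr e); apply: lerD; last exact: ltW.
  by rewrite distrC; apply: ltW; exact: h1.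
move=> h.
have [r [r0 hr]] : exists r, 0 < r /\ [set v : 'rV[R]_d | forall j, `|v 0 j| <= M%:R] `<=`
    (fun v => forall w : 'rV[R]_d, (forall j, `|v 0 j - w 0 j| < r) -> `|f v - f w| <= e).
  by near (0 : R)^'+ => r; exists r; split => //; near: r.
exists r => // v w vw.
have [hv|hv] := pselect (forall j, `|v 0 j| <= M%:R); first exact: hr.
have [hw|hw] := pselect (forall j, `|w 0 j| <= M%:R).
  by rewrite distrC; apply: hr => // j; rewrite distrC.
have z (u : 'rV[R]_d) : ~ (forall j, `|u 0 j| <= M%:R) -> f u = 0.
  move=> /existsNP[j /negP]; rewrite -ltNge => /ltW ?.
  by apply: fM; exists j.
by rewrite !z// subrr normr0 ltW.
Unshelve. all: by end_near. Qed.

End box.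

(** * Riemann sums over dyadic cells *)

Section grid_cells.
Context (R : realType) (d : nat).
Local Notation leb := (lebesgue_rV R d).
Local Notation Rint f := (\int[leb]_(x in [set: borel_rV R d]) f x).
Local Notation L1 f := (leb.-integrable [set: borel_rV R d] (EFin \o (f : borel_rV R d -> R))).

Lemma Rintegral_sum (I : Type) (r : seq I) (F : I -> 'rV[R]_d -> R) :
  (forall i, L1 (F i)) ->
  L1 (fun v => \sum_(i <- r) F i v) /\
  Rint (fun v => \sum_(i <- r) F i v) = \sum_(i <- r) Rint (F i).
Proof.
move=> FL; elim: r => [|i r [IH1 IH2]].
  have e : (fun v : 'rV[R]_d => \sum_(i <- [::]) F i v) = cst 0.
    by apply/funext => v; rewrite big_nil.
  rewrite e big_nil; split; last by rewrite Rintegral_cst// mul0r.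
  by rewrite (_ : _ \o _ = cst 0%E)//; exact: integrable0.
have e : (fun v : 'rV[R]_d => \sum_(i <- i :: r) F i v) =
    (fun v => F i v + \sum_(i <- r) F i v).
  by apply/funext => v; rewrite big_cons.
rewrite e big_cons; split; last by rewrite RintegralD// IH2.
by apply: (integrableD _ (FL i) IH1).
Qed.

Lemma integrable_box (a b : 'I_d -> R) : (forall j, a j <= b j) ->
  L1 (\1_(box a b : set (borel_rV R d))).
Proof.
move=> ab; have mb := measurable_box a b; apply/integrableP; split.
  by apply/measurable_EFinP; exact: measurable_indic.
rewrite (eq_integral (fun x => (\1_(box a b : set (borel_rV R d)) x)%:E)); last first.
  by move=> t _; rewrite gee0_abs// lee_fin.
by rewrite integral_indic// setIT lebesgue_box// ltry.
Qed.

Lemma Rint_box (a b : 'I_d -> R) : (forall j, a j <= b j) ->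
  Rint (\1_(box a b : set (borel_rV R d))) = \prod_j (b j - a j).
Proof.
move=> ab; rewrite /Rintegral integral_indic//; last exact: measurable_box.
by rewrite setIT lebesgue_box.
Qed.

Lemma integrable_scale (c : R) (f : 'rV[R]_d -> R) : L1 f -> L1 (fun v => c * f v).
Proof. by move=> fL; exact: (integrableZl measurableT c fL). Qed.

Section fixed_grid.
Variables (M n : nat).
Local Notation grid := {ffun 'I_d -> 'I_(2 * M * 2 ^ n)}.
Local Notation h := (2 ^- n : R).
Implicit Type x : grid.

(** The cells have side [2^-n] and partition the half-open cube [[-M, M[^d]; a block of level
    [n - m] with [m <= n] is a dyadic cube of side [2^-m]. *)
Definition corner x : 'rV[R]_d := \row_j ((x j)%:R * h - M%:R).

Definition cell x := box (corner x 0) (fun j => corner x 0 j + h).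

Lemma mesh_gt0 : 0 < h.
Proof. by rewrite invr_gt0 exprn_gt0. Qed.

Lemma cell_uniq x y v : cell x v -> cell y v -> x = y.
Proof.
move=> xv yv; apply/ffunP => j; apply/val_inj/eqP; rewrite eqn_leq.
have h0 := mesh_gt0.
suff H x' y' : cell x' v -> cell y' v -> (x' j <= y' j)%N by rewrite !H.
move=> /(_ j)/andP[+ _] /(_ j)/andP[_]; rewrite !mxE => xv' yv'.
have := le_lt_trans xv' yv'.
rewrite addrAC ltrD2r -[X in _ + X]mul1r -mulrDl ltr_pM2r// natr1 ltr_nat.
by rewrite ltnS.
Qed.

Lemma cell_ex (v : 'rV[R]_d) : (forall j, `|v 0 j| < M%:R) -> exists x, cell x v.
Proof.
move=> vM; have h0 := mesh_gt0.
have Mv j : 0 <= v 0 j + M%:R by have := vM j; rewrite ltr_norml => /andP[? _]; lra.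
pose t j := Num.truncn ((v 0 j + M%:R) * 2 ^+ n).
have tP j : (t j)%:R * h <= v 0 j + M%:R < (t j)%:R * h + h.
  have /andP[t1 t2] := truncn_itv (mulr_ge0 (Mv j) (exprn_ge0 n (ler0n R 2))).
  rewrite -[X in _ < _ + X]mul1r -mulrDl natr1.
  by rewrite ler_pdivrMr ?exprn_gt0// t1 ltr_pdivlMr ?exprn_gt0.
have tK j : (t j < 2 * M * 2 ^ n)%N.
  rewrite -(ltr_nat R) -(ltr_pM2r h0); have /andP[/le_lt_trans + _] := tP j.
  apply; rewrite !natrM natrX mulfK ?expf_neq0 ?pnatr_eq0//.
  by have := vM j; rewrite ltr_norml => /andP[_ ?]; lra.
exists [ffun j => Ordinal (tK j)] => j.
by rewrite !mxE ffunE /=; have /andP[? ?] := tP j; lra.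
Qed.

Lemma cell_dist x (v : 'rV[R]_d) j : cell x v -> `|v 0 j - corner x 0 j| <= h.
Proof.
move=> /(_ j)/andP[v1 v2]; rewrite ger0_norm ?subr_ge0//.
by rewrite lerBlDl; apply: ltW.
Qed.

Lemma Rint_cell x : Rint (\1_(cell x : set (borel_rV R d))) = h ^+ d.
Proof.
rewrite Rint_box; last by move=> j; rewrite lerDl ltW// mesh_gt0.
under eq_bigr do rewrite addrC addKr.
by rewrite prodr_const card_ord.
Qed.

Lemma integrable_cell x : L1 (\1_(cell x : set (borel_rV R d))).
Proof. by apply: integrable_box => j; rewrite lerDl ltW// mesh_gt0. Qed.

Lemma Rint_step (c : grid -> R) :
  L1 (fun v => \sum_x c x * \1_(cell x) v) /\
  Rint (fun v => \sum_x c x * \1_(cell x) v) = h ^+ d * \sum_x c x.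
Proof.
have [H1 H2] := @Rintegral_sum _ (index_enum grid) (fun x v => c x * \1_(cell x) v)
  (fun x => integrable_scale (c x) (integrable_cell x)).
split=> //; rewrite H2 mulr_sumr; apply: eq_bigr => x _.
by rewrite RintegralZl ?Rint_cell 1?mulrC//; exact: integrable_cell.
Qed.

Lemma card_grid_mesh : h ^+ d * \sum_(x : grid) 1 = (2 * M)%:R ^+ d.
Proof.
rewrite sumr_const card_ffun !card_ord -mulr_natl mulr1 natrX -exprMn natrM natrX.
by rewrite mulrCA mulVf ?mulr1// expf_neq0// pnatr_eq0.
Qed.

Lemma step_cell (c : grid -> R) x v : cell x v -> \sum_y c y * \1_(cell y) v = c x.
Proof.
move=> xv; rewrite (bigD1 x)//= indicE mem_set// mulr1 big1 ?addr0// => y yx.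
rewrite indicE memNset ?mulr0// => yv.
by move: yx; rewrite (cell_uniq yv xv) eqxx.
Qed.

Lemma step_out (c : grid -> R) v : ~ (exists x, cell x v) -> \sum_y c y * \1_(cell y) v = 0.
Proof.
move=> nv; rewrite big1// => x _; rewrite indicE memNset ?mulr0// => xv.
by apply: nv; exists x.
Qed.

End fixed_grid.

Lemma integrable_supp_in M (g : 'rV[R]_d -> R) : continuous g -> supp_in M g -> L1 g.
Proof.
move=> gc gM; have [C C0 gC] := supp_in_bounded gc gM.
(* The dominating function is the bound [C] on the unit cells of the cube. *)
have [H _] := @Rint_step M 0 (fun=> C).
apply: le_integrable H => //.
  by apply/measurable_EFinP; exact: continuous_measurable_rV.
move=> v _ /=; rewrite lee_fin.
have [[x xv]|nx] := pselect (exists x : {ffun 'I_d -> 'I_(2 * M * 2 ^ 0)}, cell x v).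
  by rewrite (step_cell _ xv) (ger0_norm C0).
rewrite gM ?normr0//.
by apply: contra_notP nx => /forallNP h; apply: cell_ex => j; rewrite ltNge; apply/negP; exact: h.
Qed.

Lemma mesh_small (r : R) : 0 < r -> exists n0, forall n, (n0 <= n)%N -> 2 ^- n < r.
Proof.
move=> r0; exists (Num.truncn r^-1).+1 => n nn.
rewrite invf_plt ?posrE ?exprn_gt0//.
have ri : 0 <= r^-1 by rewrite invr_ge0 ltW.
have /andP[_ /lt_trans] := truncn_itv ri; apply.
rewrite -natrX ltr_nat; apply: leq_ltn_trans nn _; exact: ltn_expl.
Qed.

(** The sample points are arbitrary near the corners, so that points given by the mean value theorem
    are allowed. On each cell [g] is uniformly close to its sample, and the cells fill a cube of
    finite volume. *)
Lemma riemann M (g : 'rV[R]_d -> R) (e : R) : continuous g -> supp_in M g -> 0 < e ->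
  exists n0, forall n, (n0 <= n)%N ->
  forall xi : {ffun 'I_d -> 'I_(2 * M * 2 ^ n)} -> 'rV[R]_d,
  (forall x j, `|xi x 0 j - corner x 0 j| <= 2 ^- n) ->
  `|Rint g - (2 ^- n) ^+ d * \sum_x g (xi x)| <= e.
Proof.
move=> gc gM e0.
(* The cube has volume [(2M)^d]; adding 1 keeps the denominator positive when [M = 0]. *)
pose e' := e / ((2 * M)%:R ^+ d + 1).
have D0 : 0 < ((2 * M)%:R ^+ d + 1 : R) by rewrite ltr_wpDl ?exprn_ge0 ?ler0n.
have e'0 : 0 < e' by rewrite divr_gt0.
have [r r0 gr] := supp_in_unif gc gM e'0.
(* A point of a cell and its sample are each within one mesh of the corner, hence the half. *)
have [n0 hn0] := mesh_small (divr_gt0 r0 (ltr0n R 2)).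
exists n0 => n /hn0 nr xi xiP.
have gL := integrable_supp_in gc gM.
have [sL sE] := Rint_step (fun x => g (xi x)).
have [tL tE] := @Rint_step M n (fun=> e').
rewrite -sE -RintegralB//.
apply: le_trans (le_normr_Rintegral _ (integrableB _ gL sL)) _ => //.
have le_e : e' * (2 * M)%:R ^+ d <= e.
  by rewrite /e' mulrAC ler_pdivrMr// ler_wpM2l ?(ltW e0)// lerDl.
apply: le_trans le_e; rewrite -(card_grid_mesh M n) mulrCA.
have -> : e' * \sum_(x : {ffun 'I_d -> 'I_(2 * M * 2 ^ n)}) 1 = \sum_(x : {ffun 'I_d -> 'I_(2 * M * 2 ^ n)}) e'.
  by rewrite mulr_sumr; under eq_bigr do rewrite mulr1.
rewrite -tE; apply: le_Rintegral => //.
  exact: integrable_norm (integrableB _ gL sL).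
move=> v _.
have [[x xv]|nx] := pselect (exists x : {ffun 'I_d -> 'I_(2 * M * 2 ^ n)}, cell x v).
  rewrite !(step_cell _ xv); apply: gr => j.
  rewrite -(subrKA (corner x 0 j)) (le_lt_trans (ler_normD _ _))//.
  rewrite (splitr r) ltrD// ?(le_lt_trans (cell_dist j xv))//.
  by rewrite distrC (le_lt_trans (xiP x j)).
rewrite !step_out// subr0 gM ?normr0//.
by apply: contra_notP nx => /forallNP h; apply: cell_ex => j; rewrite ltNge; apply/negP; exact: h.
Qed.

End grid_cells.

(** * Test functions and integration by parts *)

Section smooth_functions.
Context (R : realType) (d : nat).
Local Notation Rd := 'rV[R]_d.
Local Notation leb := (lebesgue_rV R d).
Local Notation Rint f := (\int[leb]_(x in [set: borel_rV R d]) f x).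
Local Notation L1 f := (leb.-integrable [set: borel_rV R d] (EFin \o (f : borel_rV R d -> R))).
Local Notation e_ i := (delta_mx 0 i : Rd).
Implicit Types (phi psi u : Rd -> R) (s t : seq 'I_d) (i : 'I_d).

Lemma partial_cat s t phi : partial s (partial t phi) = partial (s ++ t) phi.
Proof. by elim: s => //= i s ->. Qed.

Lemma partial_rcons s i phi : partial (rcons s i) phi = partial s (partial [:: i] phi).
Proof. by rewrite partial_cat cats1. Qed.

Lemma smooth_partial t phi : smooth phi -> smooth (partial t phi).
Proof. by move=> ph s; rewrite partial_cat; exact: ph. Qed.

Lemma smooth_continuous phi : smooth phi -> continuous phi.
Proof. by move=> /(_ [::]) []. Qed.

Lemma smooth_derivable phi i v : smooth phi -> derivable phi v (e_ i).
Proof. by move=> /(_ [::]) [_]; exact. Qed.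

Lemma partialD s phi psi : smooth phi -> smooth psi ->
  partial s (fun v => phi v + psi v) = (fun v => partial s phi v + partial s psi v).
Proof.
move=> ph ps; elim: s => [//|i s IH] /=; apply/funext => v; rewrite IH.
by apply: deriveD; [exact: (ph s).2|exact: (ps s).2].
Qed.

Lemma partialZ s (c : R) phi : smooth phi ->
  partial s (fun v => c * phi v) = (fun v => c * partial s phi v).
Proof.
move=> ph; elim: s => [//|i s IH] /=; apply/funext => v; rewrite IH.
by apply: (deriveZ c); exact: (ph s).2.
Qed.

Lemma smoothD phi psi : smooth phi -> smooth psi -> smooth (fun v => phi v + psi v).
Proof.
move=> ph ps s; rewrite partialD//; split => [v|i v].
  by apply: (@continuousD _ _ _ (partial s phi) (partial s psi)); [exact: (ph s).1|exact: (ps s).1].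
by apply: derivableD; [exact: (ph s).2|exact: (ps s).2].
Qed.

Lemma smoothZ (c : R) phi : smooth phi -> smooth (fun v => c * phi v).
Proof.
move=> ph s; rewrite partialZ//; split => [v|i v].
  by apply: continuousM; [exact: cst_continuous|exact: (ph s).1].
exact: (@derivableZ _ _ _ (partial s phi) c v (e_ i) ((ph s).2 i v)).
Qed.

Lemma partial_eq0 (U : set Rd) phi s : open U -> (forall v, U v -> phi v = 0) ->
  forall v, U v -> partial s phi v = 0.
Proof.
move=> oU phi0; elim: s => [//|i s IH] v Uv /=.
have -> : 'D_(e_ i) (partial s phi) v = 'D_(e_ i) (cst 0 : Rd -> R) v.
  apply: near_eq_derive.
  by near=> w; apply: IH; near: w; apply: open_nbhs_nbhs.
exact: derive_cst.
Unshelve. all: by end_near. Qed.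

Definition all_supp_in M phi := forall s, supp_in M (partial s phi).

(** All derivatives vanish on the open complement of the closed support, so one cube serves for all
    of them. *)
Lemma test_supp_in phi : test_function phi -> exists M, all_supp_in M phi.
Proof.
move=> [ph cphi].
have [N [_ hN]] := @compact_bounded R Rd _ cphi.
have B v : closure [set v | phi v != 0] v -> `|v| <= N + 1.
  by apply: hN; rewrite ltrDl.
exists (Num.truncn `|N + 1|).+1 => s v [j vj].
apply: (@partial_eq0 (~` closure [set v | phi v != 0])).
- exact/closed_openC/closed_closure.
- by move=> w nw; apply/eqP; apply: contra_notT nw => w0; exact: subset_closure.
- move=> /B vN; have : `|v 0 j| <= `|v|.
    by rewrite [leRHS]/Num.norm /= mx_normrE; apply/bigmax_geP; right => /=; exists (0, j).
  have /andP[_ lt] := truncn_itv (normr_ge0 (N + 1)).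
  move=> /(le_trans vj)/(lt_le_trans lt)/lt_le_trans/(_ vN).
  by rewrite ltNge ler_norm.
Qed.

Lemma supp_in_compact M phi : supp_in M phi -> compact (closure [set v | phi v != 0]).
Proof.
move=> phM; apply: (subclosed_compact _ (@compact_cube R d M%:R)); first exact: closed_closure.
have /compact_closed h : compact [set v : Rd | forall j, `|v 0 j| <= M%:R] := @compact_cube R d M%:R.
rewrite closureE => v; apply; split; first exact/h/norm_hausdorff.
move=> w /= /eqP phw j; rewrite leNgt; apply/negP => /ltW Mw.
by apply: phw; apply: phM; exists j.
Qed.

Lemma line_derive phi i (v : Rd) (t : R) : (forall w, derivable phi w (e_ i)) ->
  is_derive t 1 (fun r : R => phi (v + r *: e_ i)) ('D_(e_ i) phi (v + t *: e_ i)).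
Proof.
move=> dphi.
have E : (fun h : R => h^-1 *: (((fun r : R => phi (v + r *: e_ i)) \o shift t) (h *: (1 : R)) - phi (v + t *: e_ i)))
   = (fun h : R => h^-1 *: ((phi \o shift (v + t *: e_ i)) (h *: e_ i) - phi (v + t *: e_ i))).
  apply/funext => h; congr (_ *: (phi _ - _)) => /=.
  by rewrite scalerDl addrCA; congr (_ *: _ + _); rewrite /GRing.scale /= mulr1.
by split; rewrite /derivable /derive E //; exact: dphi.
Qed.

Lemma mean_value phi i (v : Rd) (a : R) : 0 < a -> (forall w, derivable phi w (e_ i)) ->
  exists t : R, 0 < t < a /\ phi (v + a *: e_ i) - phi v = a * 'D_(e_ i) phi (v + t *: e_ i).
Proof.
move=> a0 dphi.
have [||c] := @MVT R (fun r : R => phi (v + r *: e_ i))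
   (fun r => 'D_(e_ i) phi (v + r *: e_ i)) 0 a a0.
- by move=> x _; exact: line_derive.
- apply: derivable_within_continuous => x _.
  by have [] := line_derive v x dphi.
rewrite in_itv /= => ca; rewrite scale0r addr0 subr0 mulrC => e.
by exists c.
Qed.

Section sampling.
Variables (M n : nat).
Local Notation grid := {ffun 'I_d -> 'I_(2 * M * 2 ^ n)}.
Local Notation h := (2 ^- n : R).

(** In the last cell of a line, the wrapped corner lies on the face [-M] and the shifted one on the
    face [M]; [phi] vanishes at both. *)
Lemma corner_shift phi i (x : grid) : supp_in M phi ->
  phi (corner R (grid_succ i x)) = phi (corner R x + h *: e_ i).
Proof.
move=> phM; set y := grid_succ i x.
have y_ne j : j != i -> corner R y 0 j = (corner R x + h *: e_ i) 0 j.
  by move=> ji; rewrite !mxE !ffunE (negbTE ji) eqxx /= mulr0 addr0.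
have [lt|ge] := ltnP (x i).+1 (2 * M * 2 ^ n).
  congr phi; apply/rowP => j; have [->|/y_ne//] := eqVneq j i.
  rewrite !mxE !ffunE !eqxx /= modn_small// mulr1 -natr1 mulrDl mul1r.
  by rewrite addrAC.
have xi : (x i).+1 = (2 * M * 2 ^ n)%N by apply/eqP; rewrite eqn_leq ge ltn_ord.
rewrite !phM//; exists i; rewrite !mxE.
  rewrite !eqxx mulr1 addrAC -[X in _ + X - _]mul1r -mulrDl natr1 xi.
  rewrite !natrM natrX mulfK ?expf_neq0 ?pnatr_eq0//.
  by rewrite (_ : 2%:R * M%:R - M%:R = M%:R :> R) ?normr_nat//; ring.
by rewrite !ffunE eqxx /= xi modnn mul0r sub0r normrN normr_nat.
Qed.

Lemma sample_diff phi i (x : grid) : supp_in M phi ->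
  (forall w, derivable phi w (e_ i)) ->
  exists xi : Rd, [/\ forall j, `|xi 0 j - corner R x 0 j| <= h, cell x xi &
    phi (corner R (grid_succ i x)) - phi (corner R x) = h * 'D_(e_ i) phi xi].
Proof.
move=> phM dphi; rewrite corner_shift//.
have h0 : 0 < h by exact: mesh_gt0.
have [t [/andP[t0 th] ->]] := mean_value (corner R x) h0 dphi.
have xiE j : (corner R x + t *: e_ i) 0 j = corner R x 0 j + t * (j == i)%:R.
  by rewrite !mxE eqxx.
exists (corner R x + t *: e_ i); split => // j; rewrite xiE.
  rewrite addrAC subrr add0r; case: (j == i).
    by rewrite mulr1 gtr0_norm ?ltW.
  by rewrite mulr0 normr0 ltW.
case: (j == i); first by rewrite mulr1 lerDl ltrD2l th ltW.
by rewrite mulr0 addr0 lexx ltrDl.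
Qed.

End sampling.

(** At mean value points, the Riemann sum of the derivative is up to scaling a sum of forward
    differences, and this is zero because the cyclic successor permutes the grid. *)
Lemma Rint_derive0 M phi i : continuous phi -> supp_in M phi ->
  (forall w, derivable phi w (e_ i)) ->
  continuous ('D_(e_ i) phi) -> supp_in M ('D_(e_ i) phi) ->
  Rint ('D_(e_ i) phi) = 0.
Proof.
move=> pc phM dphi gc gM; apply/eqP; rewrite -normr_le0; apply/ler_addgt0Pl => e e0.
rewrite addr0.
have [n0 /(_ n0 (leqnn _)) H] := riemann gc gM e0.
have ex (x : {ffun 'I_d -> 'I_(2 * M * 2 ^ n0)}) := sample_diff x phM dphi.
have [xi xiP] := choice ex.
have xid x j : `|xi x 0 j - corner R x 0 j| <= 2 ^- n0 by have [] := xiP x.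
apply: le_trans (H xi xid); rewrite [X in _ - X](_ : _ = 0) ?subr0//.
apply/eqP; rewrite mulf_eq0; apply/orP; right; apply/eqP.
apply: (@mulfI _ (2 ^- n0)); first by rewrite invr_eq0 expf_neq0 ?pnatr_eq0.
rewrite mulr0 mulr_sumr.
under eq_bigr => x _ do have [_ _ <-] := xiP x.
rewrite sumrB; apply/eqP; rewrite subr_eq0; apply/eqP.
have shift_inj : injective (@grid_succ d (2 * M * 2 ^ n0) i).
  move=> x y /ffunP xy; apply/ffunP => j; have := xy j; rewrite !ffunE.
  by have [->|//] := eqVneq j i; apply: ordS_inj.
by rewrite [RHS](reindex_inj shift_inj).
Qed.

Lemma by_parts M u psi i : smooth u -> smooth psi -> all_supp_in M u -> all_supp_in M psi ->
  Rint (fun v => u v * 'D_(e_ i) psi v) = - Rint (fun v => 'D_(e_ i) u v * psi v).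
Proof.
move=> su sp uM pM.
have E : 'D_(e_ i) (fun v => u v * psi v) = (fun v => u v * 'D_(e_ i) psi v + 'D_(e_ i) u v * psi v).
  apply/funext => v.
  have := @deriveM R Rd u psi v (e_ i) (@smooth_derivable u i v su) (@smooth_derivable psi i v sp).
  by rewrite /GRing.scale /= (mulrC (psi v)).
have cu := smooth_continuous su; have cp := smooth_continuous sp.
have cdu : continuous ('D_(e_ i) u) by exact: (su [:: i]).1.
have cdp : continuous ('D_(e_ i) psi) by exact: (sp [:: i]).1.
have c1 : continuous (fun v => u v * 'D_(e_ i) psi v).
  by move=> v; exact: (continuousM (cu v) (cdp v)).
have c2 : continuous (fun v => 'D_(e_ i) u v * psi v).
  by move=> v; exact: (continuousM (cdu v) (cp v)).
have s1 : supp_in M (fun v => u v * 'D_(e_ i) psi v).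
  by move=> v hv; rewrite (uM [::] v hv : u v = 0) mul0r.
have s2 : supp_in M (fun v => 'D_(e_ i) u v * psi v).
  by move=> v hv; rewrite (pM [::] v hv : psi v = 0) mulr0.
have := @Rint_derive0 M (fun v => u v * psi v) i.
rewrite E RintegralD//; [|exact: integrable_supp_in c1 s1|exact: integrable_supp_in c2 s2].
move=> H; apply/eqP; rewrite -addr_eq0; apply/eqP; apply: H.
- by move=> v; exact: (continuousM (cu v) (cp v)).
- by move=> v hv; rewrite (uM [::] v hv : u v = 0) mul0r.
- by move=> w; apply: derivableM; exact: smooth_derivable.
- move=> v; apply: (@continuousD _ _ _ (fun v => u v * 'D_(e_ i) psi v)); [exact: c1|exact: c2].
- by move=> v hv; rewrite s1// s2// addr0.
Qed.

Lemma all_supp_partial M phi s : all_supp_in M phi -> all_supp_in M (partial s phi).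
Proof. by move=> pM t; rewrite partial_cat; exact: pM. Qed.

Lemma supp_in_le M N phi : (M <= N)%N -> supp_in M phi -> supp_in N phi.
Proof.
by move=> MN pM v [j vj]; apply: pM; exists j; rewrite (le_trans _ vj)// ler_nat.
Qed.

(** The outermost derivative of [psi] moves first and becomes the innermost one of [u], so the order
    is reversed; [rev s] records this without commuting partial derivatives. *)
Lemma by_parts_iter M u psi s : smooth u -> smooth psi -> all_supp_in M u -> all_supp_in M psi ->
  Rint (fun v => u v * partial s psi v) = (-1) ^+ size s * Rint (fun v => partial (rev s) u v * psi v).
Proof.
move=> + sp + pM; elim: s u => [|i s IH] u su uM.
  by rewrite expr0 mul1r.
have -> : Rint (fun v => u v * partial (i :: s) psi v) =
    - Rint (fun v => 'D_(e_ i) u v * partial s psi v).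
  by apply: (@by_parts M) => //; [exact: smooth_partial|exact: all_supp_partial].
rewrite (IH (partial [:: i] u)); [|exact: smooth_partial|exact: all_supp_partial].
by rewrite exprS mulN1r mulNr rev_cons partial_rcons.
Qed.

Lemma weak_partial_test phi s : test_function phi ->
  in_L1 (partial (rev s) phi) /\ is_weak_partial s phi (partial (rev s) phi).
Proof.
move=> tp; have [M pM] := test_supp_in tp; split.
  by apply: integrable_supp_in (pM _); exact: (tp.1 _).1.
move=> psi tpsi; have [N psN] := test_supp_in tpsi.
apply: (@by_parts_iter (maxn M N)); [exact: tp.1|exact: tpsi.1| |].
- by move=> t; apply: supp_in_le (pM t); exact: leq_maxl.
- by move=> t; apply: supp_in_le (psN t); exact: leq_maxr.
Qed.

End smooth_functions.

(** * Smooth functions on the line *)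

Section smooth_line.
Context (R : realType).
Implicit Types (f g : R -> R) (n m : nat) (x : R).

(** Differentiability [n] times, with no continuity asked of the last derivative; smoothness is
    [Cn n] for all [n]. *)
Fixpoint Cn n f : Prop :=
  if n is n'.+1 then exists2 g, (forall x, is_derive x 1 f (g x)) & Cn n' g else True.

Lemma CnW n f : Cn n.+1 f -> Cn n f.
Proof. by elim: n f => [//|n IH] f [g fg /IH gn]; exists g. Qed.

Lemma CnD n f g : Cn n f -> Cn n g -> Cn n (fun x => f x + g x).
Proof.
elim: n f g => [//|n IH] f g [f' ff' f'n] [g' gg' g'n].
exists (fun x => f' x + g' x); last exact: IH.
by move=> x; exact: (@is_deriveD _ _ _ f g).
Qed.

Lemma CnM n f g : Cn n f -> Cn n g -> Cn n (fun x => f x * g x).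
Proof.
elim: n f g => [//|n IH] f g fn gn; have fn' := CnW fn; have gn' := CnW gn.
case: fn => f' ff' f'n; case: gn => g' gg' g'n.
exists (fun x => f x * g' x + g x * f' x).
  by move=> x; exact: (@is_deriveM _ _ f g).
by apply: CnD; exact: IH.
Qed.

Lemma Cn_cst n (c : R) : Cn n (fun=> c).
Proof.
elim: n c => [//|n IH] c; exists (fun=> 0) => // x; exact: is_derive_cst.
Qed.

Lemma Cn_affine n f (a b : R) : Cn n f -> Cn n (fun x => f (a * x + b)).
Proof.
elim: n f => [//|n IH] f [g fg gn].
exists (fun x => g (a * x + b) * a); last by apply: CnM; [exact: IH|exact: Cn_cst].
move=> x.
have h : is_derive x 1 (fun x => a * x + b) a.
  have h1 : is_derive x 1 (fun x => a * x) a.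
    by have := @is_deriveZ R R R id a x 1 1 (is_derive_id _ _); rewrite [a *: 1]mulr1.
  have h2 : is_derive x 1 (fun _ : R => b) 0 by exact: is_derive_cst.
  by have := is_deriveD h1 h2; rewrite addr0.
exact: (@is_derive1_comp _ f (fun x => a * x + b)).
Qed.

Lemma Cn_derive1n n f : Cn n.+1 f -> forall x, is_derive x 1 (f^`(n))%classic ((f^`(n.+1))%classic x).
Proof.
elim: n f => [|n IH] f [g fg gn] x.
  by rewrite derive1n0 derive1n1 derive1E; apply: DeriveDef => //; have [] := fg x.
have e : (f^`())%classic = g.
  by apply/funext => y; rewrite derive1E; have [_] := fg y.
by rewrite derive1Sn (derive1Sn _ n.+1) e; exact: IH.
Qed.

(** The case [n = 0] is the standard flat function [exp(-1/x)]; the powers of [1/x] make the linear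
    span of the family stable under differentiation. *)
Definition flat n x : R := if 0 < x then x^-1 ^+ n * expR (- x^-1) else 0.

Lemma flat_ge0 n x : 0 <= flat n x.
Proof.
by rewrite /flat; case: ifP => // x0; rewrite mulr_ge0 ?expR_ge0// exprn_ge0// invr_ge0 ltW.
Qed.

(** Compare the exponential at [1/x] with the term of degree [n + 2] of its series. The quadratic
    bound makes the derivative at 0 vanish. *)
Lemma flat_le n x : flat n x <= (n.+2)`!%:R * x ^+ 2.
Proof.
rewrite /flat; case: ifPn => [x0|_]; last by rewrite mulr_ge0// sqr_ge0.
rewrite expRN ler_pdivrMr ?expR_gt0//.
have y0 : 0 < x^-1 by rewrite invr_gt0.
have := expR_ge1Dxn n.+1 (ltW y0).
have F0 : 0 < (n.+2)`!%:R :> R by rewrite ltr0n fact_gt0.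
move=> h; have {}h : x^-1 ^+ n.+2 / (n.+2)`!%:R <= expR x^-1 by lra.
rewrite ler_pdivrMr// in h.
have -> : x^-1 ^+ n = x ^+ 2 * x^-1 ^+ n.+2.
  by rewrite -(addn2 n) exprD mulrCA -exprMn mulfV ?expr1n ?mulr1// gt_eqF.
rewrite [leRHS](_ : _ = x ^+ 2 * (expR x^-1 * (n.+2)`!%:R)); last by ring.
by rewrite ler_wpM2l ?sqr_ge0.
Qed.

Lemma is_derive_flat n x : is_derive x 1 (flat n) (- n%:R * flat n.+1 x + flat n.+2 x).
Proof.
have [x0|x0|<-] := ltgtP 0 x.
- have xn0 : x != 0 by rewrite gt_eqF.
  apply: (@near_eq_is_derive _ _ _ ((fun y : R => y^-1) ^+ n * (expR \o (fun y : R => - y^-1)))).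
    near=> y; have y0 : 0 < y by near: y; exact: lt_nbhsr.
    by rewrite /flat y0 /= [in LHS]/GRing.mul /= fctE.
  have dV : is_derive x 1 (fun y : R => y^-1) (- x ^- 2).
    by have := @is_deriveV R id x 1 1 xn0 (is_derive_id _ _); rewrite [_ *: 1]mulr1.
  have dN : is_derive x 1 (fun y : R => - y^-1) (x ^- 2).
    by have := @is_deriveN R R R (fun y : R => y^-1) x 1 _ dV; rewrite opprK.
  have dX := @is_deriveX _ _ (fun y : R => y^-1) n x 1 _ dV.
  have dE := @is_derive1_comp _ expR (fun y : R => - y^-1) x _ _ (is_derive_expR _) dN.
  have := is_deriveM dX dE; congr (is_derive _ _ _ _).
  rewrite /flat x0 /= /GRing.scale /= !fctE.
  set E := expR _; rewrite -exprVn; set y := x^-1.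
  case: n {dX} => [|n] /=; first by rewrite !mul0r; rewrite expr0; ring.
  rewrite !exprS; ring.
- apply: (@near_eq_is_derive _ _ _ (cst 0)).
    near=> y; have y0 : y < 0 by near: y; exact: lt_nbhsl.
    by rewrite /flat ltNge (ltW y0).
  by rewrite /flat !ltNge (ltW x0) /= mulr0 addr0; exact: is_derive_cst.
(* At the origin, [flat_le] bounds the difference quotient by a constant times [|h|]. *)
have H : (fun h : R => h^-1 *: ((flat n \o shift 0) (h *: 1) - flat n 0)) @ 0^' --> (0 : R).
  have cv : (fun h : R => (n.+2)`!%:R * `|h|) @ 0^' --> (0 : R).
    have c : (fun h : R => `|h|) @ 0^' --> (0 : R).
      have c := @norm_continuous R R 0; rewrite /continuous_at normr0 in c.
      by apply: cvg_trans c; apply: cvg_app => A hA; exact: (@nbhs_dnbhs R 0 A hA).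
    rewrite -[X in _ --> X](mulr0 ((n.+2)`!%:R : R)).
    exact: (@cvgM _ _ _ _ (fun=> (n.+2)`!%:R : R) (fun h : R => `|h|) _ _ (cvg_cst _) c).
  apply/cvgr0Pnorm_lt => e e0.
  move/cvgr0Pnorm_lt : cv => /(_ e e0).
  apply: filterS => h; apply: le_lt_trans.
  rewrite /flat ltxx subr0 /= addr0 [h *: 1]mulr1 -/(flat n h) normrZ.
  rewrite (ger0_norm (flat_ge0 n h)) normfV normrM normr_id (ger0_norm (ler0n _ _)).
  have [->|h0] := eqVneq h 0; first by rewrite normr0 invr0 mul0r mulr0.
  rewrite ler_pdivrMl ?normr_gt0//; apply: le_trans (flat_le n h) _.
  by rewrite -(real_normK (num_real h)) expr2 mulrCA.
rewrite /flat !ltxx mulr0 addr0; split; first by apply/cvg_ex; exists 0.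
exact/cvg_lim.
Unshelve. all: by end_near. Qed.

Lemma Cn_flat m n : Cn m (flat n).
Proof.
elim: m n => [//|m IH] n; exists (fun x => - n%:R * flat n.+1 x + flat n.+2 x).
  exact: is_derive_flat.
by apply: CnD => //; apply: CnM => //; exact: Cn_cst.
Qed.

End smooth_line.

(** * Tensor products *)

Section tensor.
Context (R : realType) (d : nat).
Local Notation Rd := 'rV[R]_d.
Local Notation leb := (lebesgue_rV R d).
Local Notation Rint f := (\int[leb]_(x in [set: borel_rV R d]) f x).
Local Notation L1 f := (leb.-integrable [set: borel_rV R d] (EFin \o (f : borel_rV R d -> R))).
Local Notation e_ i := (delta_mx 0 i : Rd).
Implicit Types (f g : 'I_d -> R -> R) (v : Rd).

Definition tensor f v : R := \prod_j f j (v 0 j).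

Lemma continuous_tensor f : (forall j, continuous (f j)) -> continuous (tensor f).
Proof.
move=> fc; rewrite /tensor; elim: (index_enum _) => [|j r IH] v.
  rewrite (_ : (fun v => _) = cst 1); first exact: cst_continuous.
  by apply/funext => w; rewrite big_nil.
rewrite (_ : (fun v => _) = (fun v : Rd => f j (v 0 j) * \prod_(k <- r) f k (v 0 k))).
  apply: (@continuousM _ _ (fun v : Rd => f j (v 0 j))); last exact: IH.
  apply: (@continuous_comp _ _ _ (fun v : Rd => v 0 j) (f j)); last exact: fc.
  exact: coord_continuous.
by apply/funext => w; rewrite big_cons.
Qed.

Lemma tensor_derive f (i : 'I_d) (g : R -> R) v : (forall x : R, is_derive x 1 (f i) (g x)) ->
  is_derive v (e_ i) (tensor f) (tensor (fun j => if j == i then g else f j) v).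
Proof.
move=> fg.
pose P := \prod_(j | j != i) f j (v 0 j).
have TE h : tensor f (h *: e_ i + v) = f i (h *: 1 + v 0 i) * P.
  rewrite /tensor (bigD1 i)//= !mxE !eqxx mulr1 [h *: 1]mulr1; congr (_ * _).
  by apply: eq_bigr => j ji; rewrite !mxE (negbTE ji) eqxx /= mulr0 add0r.
have T0 : tensor f v = f i (v 0 i) * P by rewrite /tensor (bigD1 i).
have dE : tensor (fun j => if j == i then g else f j) v = g (v 0 i) * P.
  rewrite /tensor (bigD1 i)//= eqxx; congr (_ * _).
  by apply: eq_bigr => j /negbTE ->.
have E : (fun h : R => h^-1 *: ((tensor f \o shift v) (h *: e_ i) - tensor f v)) =
   (fun h : R => (h^-1 *: ((f i \o shift (v 0 i)) (h *: 1) - f i (v 0 i))) * P).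
  by apply/funext => h; rewrite /= TE T0 -mulrBl /GRing.scale /= mulrA.
have [der val] := fg (v 0 i).
have cv : (fun h : R => h^-1 *: ((tensor f \o shift v) (h *: e_ i) - tensor f v)) @ 0^' -->
    (g (v 0 i) * P : R).
  rewrite E; apply: cvgM; last exact: cvg_cst.
  by rewrite -val; exact: der.
rewrite dE; split; first by apply/cvg_ex; exists (g (v 0 i) * P).
exact/cvg_lim.
Qed.

Lemma is_derive_continuous (f g : R -> R) : (forall x : R, is_derive x 1 f (g x)) -> continuous f.
Proof.
move=> fg x; have [der _] := fg x.
by apply: differentiable_continuous; exact/derivable1_diffP.
Qed.

Lemma partial_tensor f s : (forall j n, Cn n (f j)) ->
  partial s (tensor f) = tensor (fun j => ((f j)^`(count_mem j s))%classic).
Proof.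
move=> fC; elim: s => [|i s IH] /=.
  by [].
apply/funext => v; rewrite IH.
have := @tensor_derive (fun j => ((f j)^`(count_mem j s))%classic) i _ v
   (Cn_derive1n (fC i _)).
move=> [_ ->]; rewrite /tensor; apply: eq_bigr => j _.
by have [->|] := eqVneq j i; rewrite ?eqxx ?add1n// eq_sym => /negbTE ->.
Qed.

Lemma smooth_tensor f : (forall j n, Cn n (f j)) -> smooth (tensor f).
Proof.
move=> fC s; rewrite partial_tensor//; split.
  by apply: continuous_tensor => j; apply: is_derive_continuous; exact: Cn_derive1n.
move=> i v.
by have [] := @tensor_derive (fun j => ((f j)^`(count_mem j s))%classic) i _ v
   (Cn_derive1n (fC i _)).
Qed.

Lemma test_tensor (M : nat) f : (forall j n, Cn n (f j)) ->
  (forall j x, M%:R <= `|x| -> f j x = 0) -> test_function (tensor f).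
Proof.
move=> fC fM; split; first exact: smooth_tensor.
apply: (@supp_in_compact _ _ M) => v [j vj].
by rewrite /tensor (bigD1 j)//= fM// mul0r.
Qed.

(** For [c > 0], a smooth function with values in [[0, 1]] that vanishes outside []a, b[]; as [c]
    grows it tends to the indicator of that interval. *)
Definition window (a b c x : R) : R := flat 0 (c * (x - a)) * flat 0 (c * (b - x)).

Lemma flat0E (x : R) : flat 0 x = if 0 < x then expR (- x^-1) else 0.
Proof. by rewrite /flat; case: ifP => //; rewrite expr0 mul1r. Qed.

Lemma flat0_le1 (x : R) : flat 0 x <= 1.
Proof. by rewrite flat0E; case: ifP => // x0; rewrite expR_le1 oppr_le0 invr_ge0 ltW. Qed.

Lemma Cn_window n a b c : Cn n (window a b c).
Proof.
apply: CnM.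
  rewrite (_ : (fun x => _) = (fun x => flat 0 (c * x + - (c * a)))).
    exact/Cn_affine/Cn_flat.
  by apply/funext => x; rewrite mulrBr.
rewrite (_ : (fun x => _) = (fun x => flat 0 (- c * x + c * b))).
  exact/Cn_affine/Cn_flat.
by apply/funext => x; rewrite mulrBr mulNr addrC.
Qed.

Lemma window_ge0 a b c x : 0 <= window a b c x.
Proof. by rewrite mulr_ge0// flat_ge0. Qed.

Lemma window_le1 a b c x : window a b c x <= 1.
Proof. by rewrite mulr_ile1 ?flat_ge0 ?flat0_le1. Qed.

Lemma window_out a b c x : 0 < c -> ~~ (a < x < b) -> window a b c x = 0.
Proof.
move=> c0; rewrite negb_and /window !flat0E => /orP[|] h.
  by rewrite pmulr_rgt0// subr_gt0 (negbTE h) mul0r.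
by rewrite [X in _ * X]ifF ?mulr0// pmulr_rgt0// subr_gt0 (negbTE h).
Qed.

Lemma cvg_flat0 (y : R^nat) : y @ \oo --> +oo -> (flat 0 (y n)) @[n --> \oo] --> (1 : R).
Proof.
move=> yoo.
have c : expR (- (y n)^-1) @[n --> \oo] --> (1 : R).
  rewrite -[X in _ --> X](expR0 R) -oppr0.
  apply: continuous_cvg; first exact: continuous_expR.
  by apply: cvgN; apply/gtr0_cvgV0 => //; move/cvgryPgt : yoo; exact.
apply: cvg_trans c; apply: near_eq_cvg.
have := yoo; move/cvgryPgt => /(_ 0); apply: filterS => n y0.
by rewrite flat0E y0.
Qed.

Lemma cvg_windowS (a b : R^nat) x :
  (fun n => n.+1%:R * (x - a n)) @ \oo --> +oo ->
  (fun n => n.+1%:R * (b n - x)) @ \oo --> +oo ->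
  (window (a n) (b n) n.+1%:R x) @[n --> \oo] --> (1 : R).
Proof.
move=> ha hb; rewrite -[X in _ --> X](mulr1 1).
by apply: cvgM; exact: cvg_flat0.
Qed.

End tensor.

(** * Uniqueness of weak derivatives *)

Section du_bois_reymond.
Context (R : realType) (d : nat).
Local Notation Rd := 'rV[R]_d.
Local Notation leb := (lebesgue_rV R d).
Local Notation Rint f := (\int[leb]_(x in [set: borel_rV R d]) f x).
Local Notation L1 f := (leb.-integrable [set: borel_rV R d] (EFin \o (f : borel_rV R d -> R))).

(** A family stable under intersection. The whole space is added because complements are handled by
    subtracting from the integral over it. *)
Definition open_boxes : set (set (borel_rV R d)) :=
  [set A | A = setT \/ exists a b : 'I_d -> R, A = [set v : Rd | forall j, a j < v 0 j < b j]].

(** An open set is the countable union of the boxes with rational vertices that it contains. *)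
Lemma open_boxes_generate : @measurable _ (borel_rV R d) = <<s open_boxes >>.
Proof.
apply/seteqP; split; last first.
  apply: smallest_sub; first exact: sigma_algebra_measurable.
  move=> _ [->|[a [b ->]]]; first exact: measurableT.
  exact: measurable_open_box.
apply: smallest_sub; first exact: smallest_sigma_algebra.
move=> U oU.
pose bx (p : {ffun 'I_d -> rat * rat}) : set Rd :=
  [set v | forall j, ratr (p j).1 < v 0 j < ratr (p j).2].
have -> : U = \bigcup_(p : {ffun 'I_d -> rat * rat})
    (if `[< bx p `<=` U >] then bx p else set0).
  apply/seteqP; split => v /=; last first.
    by case=> p _; case: asboolP => // + fx; exact.
  move=> Uv; have /nbhs_ballP[e /= e0 eU] := open_nbhs_nbhs (conj oU Uv).
  have hq j : exists q : rat * rat,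
      v 0 j - e < ratr q.1 < v 0 j /\ v 0 j < ratr q.2 < v 0 j + e.
    have /rat_in_itvoo[q1 q1P] : v 0 j - e < v 0 j by rewrite ltrBlDr ltrDl.
    have /rat_in_itvoo[q2 q2P] : v 0 j < v 0 j + e by rewrite ltrDl.
    by exists (q1, q2); move: q1P q2P; rewrite !in_itv.
  have [q qP] := choice hq.
  exists (finfun q) => //; case: asboolP; last first.
    move=> nq; exfalso; apply: nq => w wq; apply: eU; split => // i j.
    rewrite ord1 /ball/=; move: (wq j); rewrite ffunE => /andP[v1 v2].
    have [/andP[a1 _] /andP[_ a2]] := qP j.
    by rewrite ltr_distlC (lt_trans a1 v1) (lt_trans v2 a2).
  move=> _ j; rewrite ffunE.
  by have [/andP[_ ->] /andP[-> _]] := qP j.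
apply: (@countable_bigcupT_measurable _ (g_sigma_algebraType open_boxes)) => [|p].
  exact: countableP.
case: asboolP => // _; apply: sub_sigma_algebra; right.
by exists (fun j => ratr (p j).1), (fun j => ratr (p j).2).
Qed.

Lemma open_boxesI : setI_closed open_boxes.
Proof.
move=> A B [->|[a [b ->]]]; first by rewrite setTI.
move=> [->|[a' [b' ->]]]; first by rewrite setIT; right; exists a, b.
right; exists (fun j => Num.max (a j) (a' j)), (fun j => Num.min (b j) (b' j)).
apply/seteqP; split => v /=.
  move=> [h h'] j; rewrite gt_max lt_min.
  by have /andP[-> ->] := h j; have /andP[-> ->] := h' j.
move=> h; split => j; have := h j; rewrite gt_max lt_min.
  by move=> /andP[/andP[-> _] /andP[-> _]].
by move=> /andP[/andP[_ ->] /andP[_ ->]].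
Qed.

Section orthogonal.
Variable w : Rd -> R.
Hypothesis wL : L1 w.
Hypothesis w_test : forall psi, test_function psi -> Rint (fun v => w v * psi v) = 0.

(** Dominated convergence, with [|w|] as dominating function. *)
Lemma integral0_limit (psi : nat -> Rd -> R) (A : set (borel_rV R d)) : measurable A ->
  (forall n, test_function (psi n)) -> (forall n v, 0 <= psi n v <= 1) ->
  (forall v, psi n v @[n --> \oo] --> (\1_A v : R)) ->
  (\int[leb]_(v in A) (w v)%:E = 0)%E.
Proof.
move=> mA tpsi psi01 psi_cvg.
have mw : measurable_fun setT (w : borel_rV R d -> R).
  by have /measurable_EFinP := measurable_int _ wL.
have mp n : measurable_fun setT (psi n : borel_rV R d -> R).
  by apply: continuous_measurable_rV; exact/smooth_continuous/(tpsi n).1.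
have [] := @dominated_convergence _ (borel_rV R d) R leb setT measurableT
  (fun n v => (w v * psi n v)%:E) (fun v => (w v * \1_A v)%:E) (fun v => `|(w v)%:E|%E).
- by move=> n; apply/measurable_EFinP; exact: measurable_funM.
- by apply/measurable_EFinP; apply: measurable_funM => //; exact: measurable_indic.
- apply: aeW => v _; apply: cvg_EFin; first exact: nearW.
  by apply: cvgM; [exact: cvg_cst|exact: psi_cvg].
- exact: integrable_abse.
- apply: aeW => v n _; rewrite /= lee_fin normrM; have /andP[p0 p1] := psi01 n v.
  by rewrite ler_piMr// ger0_norm.
move=> _ _ H.
rewrite integral_mkcond.
have -> : ((fun v : borel_rV R d => (w v)%:E) \_ A) = (fun v => (w v * \1_A v)%:E).
  apply/funext => v; rewrite patchE indicE; case: ifP => _; first by rewrite mulr1.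
  by rewrite mulr0.
apply: cvg_unique H _ => //.
rewrite (_ : [sequence _]_n = cst 0%E); first exact: cvg_cst.
apply/funext => n /=.
have iL : leb.-integrable setT (fun v : borel_rV R d => (w v * psi n v)%:E).
  apply: le_integrable wL => //; first by apply/measurable_EFinP; exact: measurable_funM.
  move=> v _; rewrite /= lee_fin normrM; have /andP[p0 p1] := psi01 n v.
  by rewrite ler_piMr// ger0_norm.
rewrite -[LHS]fineK; last exact: integrable_fin_num.
by have := w_test (tpsi n); rewrite /Rintegral => ->.
Qed.

Lemma cvg_prod_1 (I : Type) (r : seq I) (u : I -> R^nat) :
  (forall i, u i @ \oo --> (1 : R)) -> (\prod_(i <- r) u i n) @[n --> \oo] --> (1 : R).
Proof.
move=> uc; elim: r => [|i r IH].
  rewrite (_ : (fun n => _) = cst 1); first exact: cvg_cst.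
  by apply/funext => n; rewrite big_nil.
rewrite (_ : (fun n => _) = (fun n => u i n * \prod_(k <- r) u k n)).
  by rewrite -[X in _ --> X](mulr1 1); apply: cvgM.
by apply/funext => n; rewrite big_cons.
Qed.

Lemma natS_cvg_pinfty (c : R^nat) (e : R) : 0 < e -> (\forall n \near \oo, e <= c n) ->
   (fun n => n.+1%:R * c n) @ \oo --> +oo.
Proof.
move=> e0 ec; apply/cvgryPge => A; near=> n.
have cn : e <= c n by near: n.
apply: (@le_trans _ _ (n.+1%:R * e)); last by rewrite ler_wpM2l.
rewrite -ler_pdivrMr//; apply: le_trans (ler_norm _) _.
have /andP[_ /ltW /le_trans] := truncn_itv (normr_ge0 (A / e)); apply.
by rewrite ler_nat ltnS; near: n; exact: nbhs_infty_ge.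
Unshelve. all: by end_near. Qed.

Lemma integral0_open_boxes A : open_boxes A -> (\int[leb]_(v in A) (w v)%:E = 0)%E.
Proof.
(* Windows of steepness [n + 1] approximate a box from inside; for the whole space their endpoints
   also go to infinity. *)
pose psi (a b : 'I_d -> R^nat) n : Rd -> R :=
  tensor (fun j => window (a j n) (b j n) n.+1%:R).
have psi01 a b n v : 0 <= psi a b n v <= 1.
  rewrite /psi /tensor; apply/andP; split; first by apply: prodr_ge0 => j _; exact: window_ge0.
  by apply: prodr_ile1 => j _; rewrite window_ge0 window_le1.
have tpsi a b n : test_function (psi a b n).
  pose B := \sum_j (`|a j n| + `|b j n|).
  have B0 j : `|a j n| + `|b j n| <= B.
    by rewrite /B (bigD1 j)//= lerDl sumr_ge0// => k _; rewrite addr_ge0.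
  apply: (@test_tensor _ _ (Num.truncn B).+1) => [j m|j x xB].
    exact: Cn_window.
  have : B < `|x|.
    apply: lt_le_trans xB; have B0' : 0 <= B by rewrite sumr_ge0// => k _; rewrite addr_ge0.
    by have /andP[_] := truncn_itv B0'.
  move=> Bx; apply: window_out; first by rewrite ltr0n.
  apply/negP => /andP[ax xb]; move: Bx; rewrite ltNge => /negP; apply.
  apply: le_trans (B0 j); rewrite ler_norml; apply/andP; split.
    by rewrite lerNl; have := ler_norm (- a j n); rewrite normrN; have := normr_ge0 (b j n); lra.
  by have := ler_norm (b j n); have := normr_ge0 (a j n); lra.
have pos_cvg (c : R) : 0 < c -> (fun n => n.+1%:R * c) @ \oo --> +oo.
  by move=> c0; apply: (natS_cvg_pinfty c0); exact: nearW.
have nat_ge (x : R) : \forall n \near \oo, 1 <= n.+1%:R - x.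
  near=> n; rewrite lerBrDl -natr1 lerD2r; apply: le_trans (ler_norm _) _.
  have /andP[_ /ltW /le_trans] := truncn_itv (normr_ge0 x); apply.
  by rewrite ler_nat; near: n; exact: nbhs_infty_ge.
move=> [->|[a [b ->]]].
  apply: (@integral0_limit (psi (fun _ n => - n.+1%:R) (fun _ n => n.+1%:R))) => // v.
  rewrite indicE mem_set//.
  apply: cvg_prod_1 => j; apply: cvg_windowS; apply: (natS_cvg_pinfty ltr01).
    by apply: filterS (nat_ge (- v 0 j)) => n; rewrite !opprK addrC.
  exact: nat_ge.
apply: (@integral0_limit (psi (fun j _ => a j) (fun j _ => b j))) => //; first exact: measurable_open_box.
move=> v; rewrite indicE; have [h|h] := pselect (forall j, a j < v 0 j < b j).
  rewrite mem_set//; apply: cvg_prod_1 => j; have /andP[aj bj] := h j.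
  by apply: cvg_windowS; apply: pos_cvg; rewrite subr_gt0.
rewrite memNset//; have /existsNP[j /negP jh] := h.
rewrite (_ : (fun n => _) = cst 0); first exact: cvg_cst.
apply/funext => n; rewrite /psi /tensor (bigD1 j)//= window_out ?mul0r//.
Unshelve. all: by end_near. Qed.

(** The measurable sets over which [w] has integral 0 form a Dynkin system containing [open_boxes],
    hence are all the Borel sets. *)
Lemma du_bois_reymond : {ae leb, forall v, w v = 0}.
Proof.
have H S : measurable S -> (\int[leb]_(v in S) (w v)%:E = 0)%E.
  rewrite open_boxes_generate; move: S.
  refine (@dynkin_induction _ (borel_rV R d) open_boxes
    (fun S => \int[leb]_(v in S) (w v)%:E = 0)%E open_boxes_generate open_boxesI _ _ _ _).
  - by apply: integral0_open_boxes; left.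
  - by move=> A; exact: integral0_open_boxes.
  - move=> A mA A0; have T0 := @integral0_open_boxes setT (or_introl erefl).
    rewrite -(setUv A) integral_setU//= in T0.
    + by rewrite A0 add0e in T0.
    + exact: measurableC.
    + by rewrite setUv; exact: measurable_int wL.
    + by apply/eqP; rewrite setICr.
  - move=> F mF tF F0; rewrite integral_bigcup//; last first.
      by apply: integrableS wL => //; exact: bigcup_measurable.
    by rewrite eseries0.
have := @integral_ae_eq _ (borel_rV R d) R leb setT measurableT (cst 0%E) (EFin \o w) wL.
move=> /(_ _) h; have := h (measurable_cst _) _; move=> {}h.
have : ae_eq leb setT (EFin \o w : borel_rV R d -> \bar R) (cst 0%E).
  by apply: h => E _ mE; rewrite /= H// integral0.
by apply: filterS => v /(_ I) [].
Qed.

End orthogonal.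

End du_bois_reymond.

(** * The Sobolev norm of a test function *)

Section sobolev_norm_classical.
Context (R : realType) (d : nat).
Local Notation Rd := 'rV[R]_d.
Local Notation leb := (lebesgue_rV R d).
Local Notation Rint f := (\int[leb]_(x in [set: borel_rV R d]) f x).
Local Notation L1 f := (leb.-integrable [set: borel_rV R d] (EFin \o (f : borel_rV R d -> R))).
Implicit Types (phi psi u g : Rd -> R) (s : seq 'I_d).

Lemma L1_measurable g : L1 g -> measurable_fun setT (g : borel_rV R d -> R).
Proof. by move=> gL; have /measurable_EFinP := measurable_int _ gL. Qed.

Lemma L1_test g psi : L1 g -> test_function psi -> L1 (fun v => g v * psi v).
Proof.
move=> gL tpsi; have [M psM] := test_supp_in tpsi.
have cp := smooth_continuous tpsi.1.
have [C C0 pC] := supp_in_bounded cp (psM [::]).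
apply: (le_integrable measurableT _ _ (integrable_scale C gL)).
  apply/measurable_EFinP; apply: measurable_funM; first exact: L1_measurable.
  exact: continuous_measurable_rV.
by move=> v _; rewrite /= lee_fin !normrM mulrC (ger0_norm C0) ler_wpM2r.
Qed.

Lemma L1_partial phi s : test_function phi -> L1 (partial s phi).
Proof.
move=> tp; have [M pM] := test_supp_in tp.
by apply: integrable_supp_in (pM s); exact: (tp.1 s).1.
Qed.

(** The chosen weak derivative and the classical one have the same integral against every test
    function, so [du_bois_reymond] applies to their difference. *)
Lemma weak_partial_ae phi s : test_function phi ->
  L1 (weak_partial s phi) /\ {ae leb, forall v, weak_partial s phi v = partial (rev s) phi v}.
Proof.
move=> tp; case: s => [|i s].
  by split; [exact: (L1_partial [::] tp)|exact: aeW].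
set t := i :: s.
have ex : exists g, [set g | in_L1 g /\ is_weak_partial t phi g] g.
  by exists (partial (rev t) phi); exact: weak_partial_test.
have [gL gw] : [set g | in_L1 g /\ is_weak_partial t phi g] (weak_partial t phi).
  exact: xgetPex.
split; first exact: gL.
have [pL pw] := weak_partial_test t tp.
set g := weak_partial t phi in gL gw *; set p := partial (rev t) phi in pL pw *.
have wL : L1 (fun v => g v - p v) by exact: (integrableB _ gL pL).
have H psi : test_function psi -> Rint (fun v => (g v - p v) * psi v) = 0.
  move=> tpsi; have := pw _ tpsi; rewrite (gw _ tpsi) => /(mulfI _) e.
  have {}e : Rint (fun v => g v * psi v) = Rint (fun v => p v * psi v).
    by apply: e; rewrite signr_eq0.
  rewrite (_ : (fun v => _) = (fun v => g v * psi v - p v * psi v)); last first.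
    by apply/funext => v; rewrite mulrBl.
  by rewrite RintegralB ?e ?subrr//; exact: L1_test.
have := @du_bois_reymond R d (fun v => g v - p v) wL H.
apply: (@filterS _ _ (ae_filter_ringOfSetsType leb)) => v /eqP.
by rewrite subr_eq0 => /eqP.
Qed.

Lemma test_sobolev_space k phi : test_function phi -> sobolev_space k phi.
Proof.
move=> tp; split; first exact: (L1_partial [::] tp).
by move=> i s _; exists (partial (rev s) phi); exact: weak_partial_test.
Qed.

Definition D_norm (i : nat) phi (v : Rd) : R :=
  Num.sqrt (\sum_(s : i.-tuple 'I_d) (partial s phi v) ^+ 2).

Lemma measurable_fun_sqrt_sum (I : finType) (F : I -> Rd -> R) :
  (forall i, measurable_fun setT (F i : borel_rV R d -> R)) ->
  measurable_fun setT (fun v : borel_rV R d => Num.sqrt (\sum_i F i v ^+ 2)).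
Proof.
move=> mF.
apply: (@measurableT_comp _ _ _ _ _ _ (@Num.sqrt R) _
   (fun v : borel_rV R d => \sum_i F i v ^+ 2)).
  by apply: continuous_measurable_fun; exact: sqrt_continuous.
by apply: measurable_sum => i; exact: measurable_funX.
Qed.

Lemma partial_measurable phi s : test_function phi ->
  measurable_fun setT (partial s phi : borel_rV R d -> R).
Proof. by move=> tp; apply: continuous_measurable_rV; exact: (tp.1 s).1. Qed.

Lemma integral_weak_D_norm i phi : test_function phi ->
  (\int[leb]_(v in [set: borel_rV R d]) (weak_D_norm i phi v)%:E =
   \int[leb]_(v in [set: borel_rV R d]) (D_norm i phi v)%:E)%E.
Proof.
move=> tp; apply: ge0_ae_eq_integral => //.
- apply/measurable_EFinP; apply: measurable_fun_sqrt_sum => s.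
  by apply: L1_measurable; have [] := weak_partial_ae s tp.
- by apply/measurable_EFinP; apply: measurable_fun_sqrt_sum => s; exact: partial_measurable.
- by move=> v _; rewrite lee_fin sqrtr_ge0.
- by move=> v _; rewrite lee_fin sqrtr_ge0.
have : {ae leb, forall v, forall s : i.-tuple 'I_d, weak_partial s phi v = partial (rev s) phi v}.
  have := @filter_forall _ (i.-tuple 'I_d : finType)
    (fun s : i.-tuple 'I_d => [set v : borel_rV R d | weak_partial s phi v = partial (rev s) phi v])
    (almost_everywhere leb) (ae_filter_ringOfSetsType leb).
  by apply => s; have [] := weak_partial_ae s tp.
apply: (@filterS _ _ (ae_filter_ringOfSetsType leb)) => v hv _; congr (Num.sqrt _)%:E.
(* Reversal permutes the tuples, so the reversed order of differentiation leaves the Euclidean norm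
   unchanged. *)
rewrite [RHS](reindex_inj (h := fun s : i.-tuple 'I_d => [tuple of rev s])) /=.
  by apply: eq_bigr => s _; rewrite hv.
by move=> s t /(congr1 (fun u : i.-tuple 'I_d => rev u)); rewrite /= !revK => /val_inj.
Qed.

Lemma sobolev_normE k phi : test_function phi ->
  sobolev_norm k phi = (\sum_(i < k.+1)
    \int[leb]_(v in [set: borel_rV R d]) (D_norm i phi v)%:E)%E.
Proof.
move=> tp; rewrite /sobolev_norm; case: asboolP => [_|]; last by case; exact: test_sobolev_space.
by apply: eq_bigr => i _; exact: integral_weak_D_norm.
Qed.

Lemma sobolev_norm_ge0 k u : (0 <= sobolev_norm k u)%E.
Proof.
rewrite /sobolev_norm; case: asboolP => // _; apply: sume_ge0 => i _.
by apply: integral_ge0 => v _; rewrite lee_fin sqrtr_ge0.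
Qed.

Lemma L1_norm g : L1 g -> (\int[leb]_(v in [set: borel_rV R d]) (`|g v|)%:E)%E = (Rint (fun v => `|g v|))%:E.
Proof.
move=> gL; rewrite /Rintegral fineK//; apply: integrable_fin_num => //.
exact: integrable_norm gL.
Qed.

Lemma Rint_partial_le k phi s : test_function phi -> (size s <= k)%N ->
  ((Rint (fun v => `|partial s phi v|))%:E <= sobolev_norm k phi)%E.
Proof.
move=> tp sk; rewrite sobolev_normE// -L1_norm; last exact: L1_partial.
have sk' : (size s < k.+1)%N by [].
rewrite (bigD1 (Ordinal sk'))//= -[leLHS]adde0 leeD//; last first.
  by apply: sume_ge0 => i _; apply: integral_ge0 => v _; rewrite lee_fin sqrtr_ge0.
apply: ge0_le_integral => //.
- by apply/measurable_EFinP; apply: measurableT_comp => //; exact: partial_measurable.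
- by apply/measurable_EFinP; apply: measurable_fun_sqrt_sum => t; exact: partial_measurable.
move=> v _; rewrite lee_fin /D_norm -sqrtr_sqr ler_wsqrtr//.
rewrite (bigD1 (in_tuple s))//= lerDl sumr_ge0// => t _; exact: sqr_ge0.
Qed.

Lemma sqrt_sum_le (I : finType) (x : I -> R) :
  Num.sqrt (\sum_i x i ^+ 2) <= \sum_i `|x i|.
Proof.
have H (r : seq I) : \sum_(i <- r) x i ^+ 2 <= (\sum_(i <- r) `|x i|) ^+ 2.
  elim: r => [|i r IH]; first by rewrite !big_nil expr0n.
  rewrite !big_cons sqrrD -(real_normK (num_real (x i))) -addrA lerD2l.
  by rewrite (le_trans IH)// lerDr mulrn_wge0// mulr_ge0// sumr_ge0.
rewrite -[leRHS]ger0_norm ?sumr_ge0// -sqrtr_sqr ler_wsqrtr//; exact: H.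
Qed.

Lemma sobolev_norm_le k phi : test_function phi ->
  (sobolev_norm k phi <= (\sum_(i < k.+1) \sum_(s : i.-tuple 'I_d)
     Rint (fun v => `|partial s phi v|))%:E)%E.
Proof.
move=> tp; rewrite sobolev_normE// -sumEFin; apply: lee_sum => i _.
have [FL FE] := @Rintegral_sum R d _ (index_enum (i.-tuple 'I_d : finType))
  (fun (s : i.-tuple 'I_d) v => `|partial s phi v|) (fun s : i.-tuple 'I_d => integrable_norm (L1_partial s tp)).
rewrite -FE /Rintegral fineK; last exact: integrable_fin_num.
apply: ge0_le_integral => //.
- by move=> v _; rewrite lee_fin sqrtr_ge0.
- by apply/measurable_EFinP; apply: measurable_fun_sqrt_sum => t; exact: partial_measurable.
- exact: measurable_int FL.
by move=> v _; rewrite lee_fin; exact: sqrt_sum_le.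
Qed.

End sobolev_norm_classical.

(** * Bumps adapted to dyadic cubes *)

Section bump.
Context (R : realType).

Lemma derive1n_affine (f : R -> R) (a b : R) n : (forall m, Cn m f) ->
  ((fun t => f (a * t + b))^`(n))%classic = (fun t => a ^+ n * (f^`(n))%classic (a * t + b)).
Proof.
move=> fC; elim: n => [|n IH].
  by apply/funext => t; rewrite !derive1n0 expr0 mul1r.
apply/funext => t.
have C : Cn 1 (fun t => a ^+ n * (f^`(n))%classic (a * t + b)).
  apply: CnM; first exact: Cn_cst.
  apply: Cn_affine; exists (f^`(n.+1))%classic => // x; exact: Cn_derive1n.
rewrite derive1nS IH derive1E.
have h : is_derive t 1 (fun t => a * t + b) a.
  have h1 : is_derive t 1 (fun x => a * x) a.
    by have := @is_deriveZ R R R id a t 1 1 (is_derive_id _ _); rewrite [a *: 1]mulr1.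
  have h2 : is_derive t 1 (fun _ : R => b) 0 by exact: is_derive_cst.
  by have := is_deriveD h1 h2; rewrite addr0.
have h3 := @is_derive1_comp _ (f^`(n))%classic (fun t => a * t + b) t _ _
  (Cn_derive1n (fC n.+1) _) h.
have [_ ->] := @is_deriveZ R R R _ (a ^+ n) t 1 _ h3.
by rewrite exprSr -mulrA; congr (_ * _); rewrite mulrC.
Qed.

(** On [[0, 1[] both factors of the window are at least [1/e]; the constant makes the bump at least
    2 there. *)
Definition bump1 (t : R) : R := 2 * expR 1 ^+ 2 * window (-1) 2 1 t.

Lemma Cn_bump1 n : Cn n bump1.
Proof. by apply: CnM; [exact: Cn_cst|exact: Cn_window]. Qed.

Lemma bump1_ge0 t : 0 <= bump1 t.
Proof. by rewrite mulr_ge0 ?window_ge0// mulr_ge0// exprn_ge0// expR_ge0. Qed.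

Lemma bump1_ge2 t : 0 <= t < 1 -> 2 <= bump1 t.
Proof.
move=> /andP[t0 t1].
have fl (x : R) : 1 <= x -> (expR 1)^-1 <= flat 0 x.
  move=> x1; rewrite flat0E ifT; last by lra.
  by rewrite -expRN ler_expR lerN2 invf_le1//; lra.
rewrite /bump1 /window -mulrA ler_peMr// -ler_pdivrMl ?exprn_gt0 ?expR_gt0// mulr1.
rewrite -exprVn expr2 ler_pM// ?invr_ge0 ?expR_ge0//; apply: fl; lra.
Qed.

Lemma bump1_out n t : 2 < `|t| -> (bump1^`(n))%classic t = 0.
Proof.
elim: n t => [|n IH] t t2.
  rewrite derive1n0 /bump1 window_out ?mulr0//; apply/negP => /andP[h1 h2].
  by move: t2; rewrite ltNge ler_norml => /negP; apply; apply/andP; split; lra.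
rewrite derive1nS derive1E.
rewrite (_ : 'D_1 _ t = 'D_1 (cst 0 : R -> R) t); first exact: derive_cst.
apply: near_eq_derive.
have oU : open [set t : R | 2 < `|t|].
  by apply: (@open_comp _ _ (@Num.norm R R) [set x | 2 < x]) => [x _|]; [exact: norm_continuous|exact: open_gt].
by near=> u; apply: IH; near: u; apply: open_nbhs_nbhs.
Unshelve. all: by end_near. Qed.

Lemma bump1_bounded k : exists2 B : R, 1 <= B & forall n t, (n <= k)%N ->
  `|(bump1^`(n))%classic t| <= B.
Proof.
have one n : exists B : R, forall t, `|(bump1^`(n))%classic t| <= B.
  have cf : continuous (bump1^`(n))%classic.
    by apply: is_derive_continuous => x; exact: (Cn_derive1n (Cn_bump1 n.+1) x).
  have [||c _ cm] := @EVT_max R (fun t => `|(bump1^`(n))%classic t|) (-2) 2.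
  - by lra.
  - apply: continuous_subspaceT => v.
    by apply: (@continuous_comp _ _ _ (bump1^`(n))%classic (@Num.norm R R)); [exact: cf|exact: norm_continuous].
  exists `|(bump1^`(n))%classic c| => t.
  have [t2|t2] := ltP 2 `|t|; first by rewrite bump1_out// normr0.
  by apply: cm; rewrite in_itv /= -ler_norml.
have [b hb] := choice one.
exists (1 + \sum_(n < k.+1) `|b n|); first by rewrite lerDl sumr_ge0.
move=> n t nk; apply: le_trans (hb n t) _; apply: le_trans (ler_norm _) _.
have nk' : (n < k.+1)%N by [].
rewrite (bigD1 (Ordinal nk'))//= addrCA lerDl addr_ge0// sumr_ge0//.
Qed.

End bump.

(** * Sublinearity of the Sobolev norm and scaling of bumps *)

Section classical_norm.
Context (R : realType) (d k : nat).
Local Notation Rd := 'rV[R]_d.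
Local Notation leb := (lebesgue_rV R d).
Local Notation Rint f := (\int[leb]_(x in [set: borel_rV R d]) f x).
Local Notation L1 f := (leb.-integrable [set: borel_rV R d] (EFin \o (f : borel_rV R d -> R))).

(** A real-valued substitute for the Sobolev norm, subadditive term by term. On test functions it is
    at least [sobolev_norm] and at most [tuple_count] times it. *)
Definition classical_norm (phi : Rd -> R) : R :=
  \sum_(i < k.+1) \sum_(s : i.-tuple 'I_d) Rint (fun v => `|partial s phi v|).

Lemma test_functionD phi psi : test_function phi -> test_function psi ->
  test_function (fun v : Rd => phi v + psi v).
Proof.
move=> tp tq; have [M pM] := test_supp_in tp; have [N qN] := test_supp_in tq.
split; first exact: smoothD tp.1 tq.1.
apply: (@supp_in_compact _ _ (maxn M N)) => v hv.
rewrite (supp_in_le (leq_maxl M N) (pM [::]) hv : phi v = 0).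
by rewrite (supp_in_le (leq_maxr M N) (qN [::]) hv : psi v = 0) addr0.
Qed.

Lemma test_functionZ (c : R) phi : test_function phi -> test_function (fun v : Rd => c * phi v).
Proof.
move=> tp; have [M pM] := test_supp_in tp.
split; first exact: smoothZ tp.1.
by apply: (@supp_in_compact _ _ M) => v hv; rewrite (pM [::] v hv : phi v = 0) mulr0.
Qed.

Lemma test_function0 : test_function (fun _ : Rd => 0 : R).
Proof.
have E s : partial s (fun _ : Rd => 0 : R) = (fun=> 0).
  elim: s => [//|i s IH] /=; rewrite IH; apply/funext => v.
  exact: (derive_cst (0 : R)).
split; last by apply: (@supp_in_compact _ _ 0) => v.
move=> s; rewrite E; split; first exact: cst_continuous.
by move=> i v; exact: (derivable_cst (0 : R)).
Qed.

Lemma classical_normD phi psi : test_function phi -> test_function psi ->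
  classical_norm (fun v => phi v + psi v) <= classical_norm phi + classical_norm psi.
Proof.
move=> tp tq; rewrite /classical_norm -big_split; apply: ler_sum => i _.
rewrite -big_split; apply: ler_sum => s _ /=; rewrite partialD; [|exact: tp.1|exact: tq.1].
have pL := L1_partial s tp; have qL := L1_partial s tq.
rewrite -RintegralD//; [|exact: integrable_norm pL|exact: integrable_norm qL].
apply: le_Rintegral => //.
- exact: integrable_norm (integrableD _ pL qL).
- exact: integrableD _ (integrable_norm pL) (integrable_norm qL).
- by move=> v _; exact: ler_normD.
Qed.

Lemma classical_normZ (c : R) phi : 0 <= c -> test_function phi ->
  classical_norm (fun v => c * phi v) = c * classical_norm phi.
Proof.
move=> c0 tp; rewrite /classical_norm mulr_sumr; apply: eq_bigr => i _.
rewrite mulr_sumr; apply: eq_bigr => s _; rewrite partialZ; last exact: tp.1.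
rewrite -RintegralZl//; last exact: integrable_norm (L1_partial s tp).
by apply: eq_Rintegral => v _; rewrite normrM ger0_norm.
Qed.

Lemma classical_norm0 : classical_norm (fun=> 0) = 0.
Proof.
transitivity (classical_norm (fun _ : Rd => 0 * 0)).
  by congr classical_norm; apply/funext => v; rewrite mul0r.
by rewrite (classical_normZ (lexx 0) test_function0) mul0r.
Qed.

Lemma classical_norm_sum (I : Type) (r : seq I) (c : I -> R) (eta : I -> Rd -> R) :
  (forall i, 0 <= c i) -> (forall i, test_function (eta i)) ->
  test_function (fun v => \sum_(i <- r) c i * eta i v) /\
  classical_norm (fun v => \sum_(i <- r) c i * eta i v) <=
    \sum_(i <- r) c i * classical_norm (eta i).
Proof.
move=> c0 te; elim: r => [|i r [IH1 IH2]].
  rewrite big_nil (_ : (fun v => _) = (fun=> 0)).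
    by split; [exact: test_function0|rewrite classical_norm0].
  by apply/funext => v; rewrite big_nil.
rewrite (_ : (fun v => _) = (fun v => c i * eta i v + \sum_(j <- r) c j * eta j v)).
  split; first by apply: test_functionD => //; exact: test_functionZ.
  rewrite big_cons; apply: le_trans (classical_normD _ IH1) _; first exact: test_functionZ.
  by rewrite classical_normZ// lerD2l.
by apply/funext => v; rewrite big_cons.
Qed.

(** Rescale a tensor product of bumps to side [2^-m]: derivatives of order at most [k] cost at most
    [2^(m k)], and the support lies in a cube of side [5 * 2^-m]. *)
Lemma bump_cube : (0 < d)%N -> exists2 C : R, 0 < C & forall (m : nat) (a : 'I_d -> R),
  exists eta : Rd -> R, [/\ test_function eta, forall v, 0 <= eta v,
    forall v, box a (fun j => a j + 2 ^- m) v -> 1 < eta v &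
    classical_norm eta <= C * 2 ^+ (m * k) * (2 ^- m) ^+ d].
Proof.
move=> d0; have [B B1 hB] := @bump1_bounded R k.
have B0 : 0 < B by lra.
exists ((\sum_(i < k.+1) \sum_(s : i.-tuple 'I_d) 1) * (B * 5) ^+ d).
  rewrite mulr_gt0 ?exprn_gt0//; last by lra.
  rewrite big_ord_recl ltr_pwDl//; last by rewrite sumr_ge0// => i _; rewrite sumr_ge0.
  by rewrite sumr_const card_tuple expn0 mulr1n.
move=> m a.
pose f j (t : R) := bump1 (2 ^+ m * t + - (2 ^+ m * a j)).
have l0 : 0 < 2 ^+ m :> R by rewrite exprn_gt0.
have i0 : 0 < 2 ^- m :> R by rewrite invr_gt0.
have fC j n : Cn n (f j) by apply: Cn_affine; exact: Cn_bump1.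
have fE j (t : R) : 2 ^+ m * t + - (2 ^+ m * a j) = (t - a j) / 2 ^- m.
  by rewrite -mulrBr mulrC invrK.
have tf : test_function (tensor f).
  pose A := \sum_j `|a j| + 2.
  have aA j : `|a j| + 2 <= A by rewrite /A lerD2r (bigD1 j)//= lerDl sumr_ge0.
  have A0 : 0 <= A by rewrite /A addr_ge0// sumr_ge0.
  apply: (@test_tensor _ _ (Num.truncn A).+1) => // j x xA.
  have Ax : A < `|x| by apply: lt_le_trans xA; have /andP[] := truncn_itv A0.
  rewrite /f fE; apply: (@bump1_out R 0); rewrite normrM normrV ?unitfE ?gt_eqF//.
  rewrite (gtr0_norm i0) ltr_pdivlMr//.
  have : (2 ^- m : R) <= 1 by rewrite invf_le1// exprn_ege1// ler1n.
  have := aA j; have := ler_normD (x - a j) (a j); rewrite subrK => ? ? ?; lra.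
exists (tensor f); split => //.
- by move=> v; apply: prodr_ge0 => j _; exact: bump1_ge0.
- move=> v va.
  have h j : 2 <= f j (v 0 j).
    apply: bump1_ge2; rewrite fE; have /andP[v1 v2] := va j.
    by rewrite divr_ge0 ?subr_ge0 ?(ltW i0)//= ltr_pdivrMr// mul1r ltrBlDl.
  (* Each factor is at least 2, and [2^d > 1] because [d > 0]. *)
  apply: (@lt_le_trans _ _ (2 ^+ d)); first by rewrite exprn_egt1 -?lt0n ?ltr1n.
  rewrite /tensor -{1}(card_ord d) -prodr_const.
  by apply: ler_prod => j _; rewrite h ler0n.
(* In rescaled coordinates the bump vanishes for [|t| > 2]. The upper end is 3 because [box]
   excludes its upper face. *)
- pose Q := box (fun j => a j - 2 * 2 ^- m) (fun j => a j + 3 * 2 ^- m) : set (borel_rV R d).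
  have bnd s v : (size s <= k)%N -> `|partial s (tensor f) v| <= 2 ^+ (m * k) * B ^+ d * \1_Q v.
    move=> sk; rewrite partial_tensor//.
    rewrite indicE; have [vQ|nvQ] := pselect (Q v).
      rewrite mem_set// mulr1 /tensor normr_prod.
      (* The factor [j] is differentiated as often as [j] occurs in [s]; these multiplicities add up
         to [size s <= k]. *)
      apply: (@le_trans _ _ (\prod_j ((2 ^+ m) ^+ count_mem j s * B))).
        apply: ler_prod => j _; rewrite normr_ge0 /= /f derive1n_affine; last exact: Cn_bump1.
        rewrite normrM ger0_norm ?exprn_ge0 ?ler_wpM2l ?exprn_ge0//.
        by apply: hB; apply: leq_trans (count_size _ _) sk.
      rewrite big_split prodr_const card_ord /= ler_wpM2r ?exprn_ge0 ?(ltW B0)//.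
      rewrite -expr_sum exprM ler_weXn2l// ?exprn_ege1// ?ler1n//.
      rewrite (leq_trans _ sk)//.
      have -> : (\sum_j count_mem j s = size s)%N; last by [].
      elim: (s) => [|i r IH]; first by rewrite big1.
      by rewrite /= big_split /= IH (bigD1 i)//= eqxx big1 ?addn0// => j /negbTE; rewrite eq_sym => ->.
    rewrite memNset// mulr0.
    have [j jh] : exists j, ~ (a j - 2 * 2 ^- m <= v 0 j < a j + 3 * 2 ^- m) by exact/existsNP.
    rewrite /tensor (bigD1 j)//= /f derive1n_affine; last exact: Cn_bump1.
    rewrite bump1_out ?mulr0 ?mul0r ?normr0// fE normrM normrV ?unitfE ?gt_eqF//.
    rewrite (gtr0_norm i0) ltr_pdivlMr// ltNge ler_norml; apply/negP => /andP[h1 h2].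
    by apply: jh; apply/andP; split; lra.
  rewrite /classical_norm [leRHS](_ : _ = \sum_(i < k.+1) \sum_(s : i.-tuple 'I_d)
     2 ^+ (m * k) * B ^+ d * (5 * 2 ^- m) ^+ d); last first.
    rewrite -!mulrA mulr_suml; apply: eq_bigr => i _; rewrite mulr_suml.
    by apply: eq_bigr => s _; rewrite !exprMn; ring.
  apply: ler_sum => i _; apply: ler_sum => s _.
  have QP j : a j - 2 * 2 ^- m <= a j + 3 * 2 ^- m by move: (ltW i0); lra.
  have QL := integrable_box QP.
  have -> : (5 * 2 ^- m) ^+ d = Rint (\1_Q).
    rewrite Rint_box// -[d in LHS]card_ord -prodr_const; apply: eq_bigr => j _; ring.
  rewrite -RintegralZl//; apply: le_Rintegral => //.
  + exact: integrable_norm (L1_partial s tf).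
  + exact: integrable_scale.
  + by move=> v _; apply: bnd; rewrite size_tuple -ltnS.
Qed.

End classical_norm.

(** * From layers to the Choquet integral *)

Section monotone.
Context (dd : measure_display) (T : measurableType dd) (R : realType).
Variable mu : {measure set T -> \bar R}.
Local Open Scope ereal_scope.

(* The measurability of [t |-> cap_open k {|phi| > t}] is not at hand, which rules
   out [ge0_le_integral]. *)
Lemma ge0_le_integral_nomeas (D : set T) (f g : T -> \bar R) :
  (forall x, D x -> 0 <= f x) -> (forall x, D x -> f x <= g x) ->
  \int[mu]_(x in D) f x <= \int[mu]_(x in D) g x.
Proof.
move=> f0 fg; rewrite !ge0_integralE//; last by move=> x Dx; exact: le_trans (f0 x Dx) (fg x Dx).
apply: le_ereal_sup => _ [h hf <-]; exists h => // x; apply: le_trans (hf x) _.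
by rewrite !patchE; case: ifPn => // /set_mem; exact: fg.
Qed.

End monotone.

Section choquet.
Context (R : realType) (d k M n : nat).
Local Notation Rd := 'rV[R]_d.
Local Notation grid := {ffun 'I_d -> 'I_(2 * M * 2 ^ n)}.
Local Notation h := (2 ^- n : R).
Implicit Types (x y : grid) (m : nat).

(** For [m <= n], the lower corner of the dyadic cube of side [2^-m] containing the cell [x]. *)
Definition cube_corner m x : 'I_d -> R :=
  fun j => (x j %/ 2 ^ (n - m))%:R * 2 ^- m - M%:R.

Lemma cube_corner_eq m x y : same_block (n - m) x y -> cube_corner m x = cube_corner m y.
Proof. by move=> /forallP xy; apply/funext => j; rewrite /cube_corner (eqP (xy j)). Qed.

Lemma mesh_scale m : (m <= n)%N -> (2 ^ (n - m))%:R * h = 2 ^- m :> R.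
Proof.
move=> mn; have e : 2 ^+ n = 2 ^+ (n - m) * 2 ^+ m :> R by rewrite -exprD subnK.
by rewrite natrX e invfM mulrA mulfV ?mul1r// expf_neq0 ?pnatr_eq0.
Qed.

Lemma cell_cube m x (v : Rd) : (m <= n)%N -> cell x v ->
  box (cube_corner m x) (fun j => cube_corner m x j + 2 ^- m) v.
Proof.
move=> mn xv j; have /andP[] := xv j; rewrite !mxE /cube_corner => v1 v2.
set p := (2 ^ (n - m))%N; set q := (x j %/ p)%N.
have p0 : (0 < p)%N by rewrite expn_gt0.
have hm : 2 ^- m = p%:R * h :> R by rewrite mesh_scale.
have h0 : 0 < h by exact: mesh_gt0.
have q1 : q%:R * 2 ^- m <= (x j)%:R * h.
  by rewrite hm mulrA -natrM ler_wpM2r ?(ltW h0)// ler_nat leq_trunc_div.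
have q2 : (x j)%:R * h + h <= q%:R * 2 ^- m + 2 ^- m.
  rewrite hm mulrA -natrM -[X in _ + X <= _]mul1r -mulrDl -[leRHS]mulrDl natr1 -natrD.
  rewrite ler_wpM2r ?(ltW h0)// ler_nat -[X in (_ + X)%N]mul1n -mulnDl addn1.
  by rewrite -ltn_divLR// ltnS.
by apply/andP; split; lra.
Qed.

Variables (c : nat -> grid -> R).
Hypothesis c_ge0 : forall m x, 0 <= c m x.
Hypothesis c_const : forall m, block_const (n - m) (c m).

Definition level_sum m x : R := \sum_(j < m) c j x.

Definition active (t : R) m x := level_sum m x <= t < level_sum m.+1 x.

Lemma level_sum_const m p x y : (m <= p.+1)%N -> same_block (n - p) x y ->
  level_sum m x = level_sum m y.
Proof.
move=> mp xy; apply: eq_bigr => j _; apply: c_const; apply: same_block_le xy.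
by rewrite leq_sub2l// -ltnS (leq_trans (ltn_ord j)).
Qed.

Lemma active_const t m x y : same_block (n - m) x y -> active t m x = active t m y.
Proof. by move=> xy; rewrite /active !(level_sum_const _ xy). Qed.

Lemma active_ex t x : 0 <= t -> t < level_sum n.+1 x ->
  exists2 m, (m < n.+1)%N & active t m x.
Proof.
move=> t0; elim: n.+1 => [|p IH]; first by rewrite /level_sum big_ord0 ltNge t0.
move=> tp; have [/IH[m mp am]|pt] := ltP t (level_sum p x).
  by exists m => //; rewrite (leq_trans mp).
by exists p => //; rewrite /active pt.
Qed.

(* The weight of a cube is spread over its [2^(d (n - m))] cells. *)
Lemma cap_open_level (C : R) (phi : Rd -> R) (t : R) :
  (forall (m : nat) (a : 'I_d -> R),
  exists eta : Rd -> R, [/\ test_function eta, forall v, 0 <= eta v,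
    forall v, box a (fun j => a j + 2 ^- m) v -> 1 < eta v &
    classical_norm k eta <= C * 2 ^+ (m * k) * (2 ^- m) ^+ d]) ->
  (forall x v, cell x v -> `|phi v| <= \sum_(m < n.+1) c m x) ->
  (forall v, ~ (exists x, cell x v) -> phi v = 0) ->
  0 <= t ->
  (cap_open k [set v | (t < `|phi v|)%R] <=
   (\sum_x \sum_(m < n.+1) C * 2 ^+ (m * k) * h ^+ d * (active t m x)%:R)%:E)%E.
Proof.
move=> Heta phic phi0 t0.
have /choice[eta etaP] : forall ma : nat * ('I_d -> R), exists eta : Rd -> R,
  [/\ test_function eta, forall v, 0 <= eta v,
    forall v, box ma.2 (fun j => ma.2 j + 2 ^- ma.1) v -> 1 < eta v &
    classical_norm k eta <= C * 2 ^+ (ma.1 * k) * (2 ^- ma.1) ^+ d].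
  by move=> [m a]; exact: Heta.
pose w (mx : 'I_n.+1 * grid) : R :=
  (active t mx.1 mx.2)%:R * ((2 ^ (n - mx.1)) ^ d)%:R^-1.
pose E (mx : 'I_n.+1 * grid) := eta (mx.1 : nat, cube_corner mx.1 mx.2).
have w0 mx : 0 <= w mx by rewrite mulr_ge0 ?ler0n// invr_ge0 ler0n.
have tE mx : test_function (E mx) by have [] := etaP (mx.1 : nat, cube_corner mx.1 mx.2).
have [tPsi nPsi] := @classical_norm_sum R d k _ (index_enum ('I_n.+1 * grid)%type) w E w0 tE.
apply: ge_ereal_sup => _ [K [cK KU] <-].
apply: (@le_trans _ _ (classical_norm k (fun v => \sum_mx w mx * E mx v))%:E); last first.
  rewrite lee_fin; apply: le_trans nPsi _.
  rewrite exchange_big pair_big /=; apply: ler_sum => -[m x] _.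
  have [_ _ _ en] := etaP (m : nat, cube_corner m x).
  apply: le_trans (ler_wpM2l (w0 (m, x)) en) _; rewrite /w /= le_eqVlt; apply/orP; left; apply/eqP.
  have hm : ((2 ^ (n - m)) ^ d)%:R * h ^+ d = (2 ^- m) ^+ d :> R.
    by rewrite natrX -exprMn mesh_scale// -ltnS.
  rewrite -hm; field; rewrite pnatr_eq0 -lt0n !expn_gt0//.
apply: le_trans (sobolev_norm_le k tPsi); apply: ereal_inf_lbound.
exists (fun v => \sum_mx w mx * E mx v) => //; split => //.
  move=> v; apply: sumr_ge0 => mx _; rewrite mulr_ge0//.
  by have [_ + _ _] := etaP (mx.1 : nat, cube_corner mx.1 mx.2); exact.
(* A point where [|phi| > t] lies in a cell, and one of the cubes containing that cell is active;
   its bump alone already exceeds 1. *)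
move=> v /KU /= tv.
have [x xv] : exists x, cell x v.
  by apply: contrapT => /phi0 v0; move: tv; rewrite v0 normr0 ltNge t0.
have [m mn am] := active_ex t0 (lt_le_trans tv (phic x v xv)).
have mn' : (m <= n)%N by [].
pose m' := Ordinal mn.
have [_ e0 e1 _] := etaP (m, cube_corner m x).
apply: (@lt_le_trans _ _ (eta (m, cube_corner m x) v)); first exact/e1/cell_cube.
rewrite -(pair_big xpredT xpredT (fun i y => w (i, y) * E (i, y) v)) /=.
rewrite (bigD1 m')//= -[leLHS]addr0 lerD//; last first.
  apply: sumr_ge0 => i _; apply: sumr_ge0 => y _; rewrite mulr_ge0//.
  by have [_ + _ _] := etaP (i : nat, cube_corner i y); exact.
rewrite (bigID (same_block (n - m) x)) /= -[leLHS]addr0 lerD//; last first.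
  apply: sumr_ge0 => y _; rewrite mulr_ge0//.
  by have [_ + _ _] := etaP (m, cube_corner m y); exact.
(* All cells of the active cube are active and carry the same bump; their weights add up to 1. *)
rewrite (eq_bigr (fun=> ((2 ^ (n - m)) ^ d)%:R^-1 * eta (m, cube_corner m x) v)); last first.
  move=> y xy; rewrite /w /E /= -(cube_corner_eq xy) -(active_const t xy) am mul1r//.
rewrite sumr_const card_block; last by rewrite dvdn_mull// dvdn_exp2l// leq_subr.
by rewrite -mulrnAl -mulr_natl mulfV ?mul1r.
Qed.

Lemma cap_open_ge0 (U : set Rd) : (0 <= cap_open k U)%E.
Proof.
apply: (@le_trans _ _ (cap_compact k set0)).
  by apply: le_ereal_inf_tmp => _ [phi _ <-]; exact: sobolev_norm_ge0.
apply: ereal_sup_ubound; exists set0 => //; split; [exact: compact0|exact: sub0set].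
Qed.

(** Integrate [cap_open_level] over [t]: at a given cell, layer [m] is active on an interval of
    length [c m x]. *)
Lemma choquet_le_layers (C : R) (phi : Rd -> R) : 0 <= C ->
  (forall (m : nat) (a : 'I_d -> R),
  exists eta : Rd -> R, [/\ test_function eta, forall v, 0 <= eta v,
    forall v, box a (fun j => a j + 2 ^- m) v -> 1 < eta v &
    classical_norm k eta <= C * 2 ^+ (m * k) * (2 ^- m) ^+ d]) ->
  (forall x v, cell x v -> `|phi v| <= \sum_(m < n.+1) c m x) ->
  (forall v, ~ (exists x, cell x v) -> phi v = 0) ->
  (choquet_integral k phi <=
   (C * (h ^+ d * \sum_x \sum_(m < n.+1) 2 ^+ (m * k) * c m x))%:E)%E.
Proof.
move=> C0 Heta phic phi0; rewrite /choquet_integral.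
apply: (@le_trans _ _ (\int[lebesgue_measure]_(t in `[0%R, +oo[)
   (\sum_x \sum_(m < n.+1) C * 2 ^+ (m * k) * h ^+ d * (active t m x)%:R)%:E)%E).
  apply: ge0_le_integral_nomeas => t; first by move=> _; exact: cap_open_ge0.
  by rewrite /= in_itv /= andbT => t0; exact: cap_open_level.
pose I m x : set R := `[level_sum m x, level_sum m.+1 x[%classic.
have aE t m x : (active t m x)%:R = \1_(I m x) t :> R.
  by rewrite indicE /active /I mem_setE in_itv.
have w0 m : 0 <= C * 2 ^+ (m * k) * h ^+ d.
  by rewrite !mulr_ge0 ?exprn_ge0// invr_ge0 exprn_ge0.
under eq_integral do rewrite pair_big -sumEFin /=.
rewrite ge0_integral_sum//; last 2 first.
- move=> [x m]; apply/measurable_EFinP; apply: measurable_funM => //.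
  rewrite (_ : (fun t => _) = \1_(I m x)); first by apply: measurable_indic; exact: measurable_itv.
  by apply/funext => t; exact: aE.
- by move=> [x m] t _; rewrite lee_fin; apply: mulr_ge0; [exact: w0|exact: ler0n].
rewrite mulr_sumr mulr_sumr.
under [X in (_ <= X%:E)%E]eq_bigr do rewrite !mulr_sumr.
rewrite pair_big -sumEFin /=; apply: lee_sum => -[x m] _ /=.
under eq_integral do rewrite EFinM aE.
rewrite ge0_integralZl//; last 2 first.
- by apply/measurable_EFinP; apply: measurable_indic; exact: measurable_itv.
- by rewrite lee_fin; exact: w0.
rewrite integral_indic//; last exact: measurable_itv.
have -> : (C * (h ^+ d * (2 ^+ (m * k) * c m x)))%:E =
   ((C * 2 ^+ (m * k) * h ^+ d)%:E * (c m x)%:E)%E.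
  by rewrite -EFinM; congr EFin; ring.
apply: lee_wpmul2l; first by rewrite lee_fin.
apply: (@le_trans _ _ (lebesgue_measure (I m x))).
  apply: le_measure; rewrite ?inE; [|exact: measurable_itv|exact: subIsetl].
  by apply: measurableI; exact: measurable_itv.
rewrite lebesgue_measure_itv /= lte_fin; case: ifP => _; last by rewrite lee_fin; exact: c_ge0.
by rewrite -EFinB lee_fin /level_sum big_ord_recr /= addrAC subrr add0r.
Qed.

End choquet.

(** * Existence of layers *)

Section sampling_norms.
Context (R : realType) (d : nat).
Local Notation Rd := 'rV[R]_d.
Local Notation leb := (lebesgue_rV R d).
Local Notation Rint f := (\int[leb]_(x in [set: borel_rV R d]) f x).
Local Notation e_ i := (delta_mx 0 i : Rd).
Local Notation grid M n := {ffun 'I_d -> 'I_(2 * M * 2 ^ n)}.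
Implicit Types (phi : Rd -> R).

Lemma riemann_norm M phi (e : R) : continuous phi -> supp_in M phi -> 0 < e ->
  exists n0, forall n, (n0 <= n)%N ->
  forall xi : grid M n -> Rd, (forall x j, `|xi x 0 j - corner R x 0 j| <= 2 ^- n) ->
  (2 ^- n) ^+ d * \sum_x `|phi (xi x)| <= Rint (fun v => `|phi v|) + e.
Proof.
move=> pc pM e0.
have cn : continuous (fun v => `|phi v|).
  by move=> v; apply: (@continuous_comp _ _ _ phi (@Num.norm R R)); [exact: pc|exact: norm_continuous].
have sn : supp_in M (fun v => `|phi v|) by move=> v hv; rewrite pM// normr0.
have [n0 H] := riemann cn sn e0.
exists n0 => n /H{}H xi /H.
by rewrite distrC => /(le_trans (ler_norm _)); rewrite lerBlDl.
Qed.

Lemma sample_norm M phi (e : R) : continuous phi -> supp_in M phi -> 0 < e ->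
  exists n0, forall n, (n0 <= n)%N ->
  (2 ^- n) ^+ d * \sum_(x : grid M n) `|phi (corner R x)| <= Rint (fun v => `|phi v|) + e.
Proof.
move=> pc pM e0; have [n0 H] := riemann_norm pc pM e0.
exists n0 => n /H; apply=> x j.
by rewrite subrr normr0 invr_ge0 exprn_ge0.
Qed.

Lemma sample_gradient M n phi i (x : grid M n) : smooth phi -> all_supp_in M phi ->
  exists xi : Rd, [/\ forall j, `|xi 0 j - corner R x 0 j| <= 2 ^- n, cell x xi &
    2 ^+ n * diff i (phi \o @corner R d M n) x = `|partial [:: i] phi xi|].
Proof.
move=> sp pM.
have [xi [x1 x2 x3]] := sample_diff x (pM [::]) (fun w => @smooth_derivable R d phi i w sp).
exists xi; split => //; rewrite /diff /= x3 normrM.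
by rewrite gtr0_norm ?invr_gt0 ?exprn_gt0// mulrA mulfV ?mul1r.
Qed.

Lemma sample_gradient_norm M phi i (e : R) : smooth phi -> all_supp_in M phi -> 0 < e ->
  exists n0, forall n, (n0 <= n)%N ->
  (2 ^- n) ^+ d * \sum_(x : grid M n) 2 ^+ n * diff i (phi \o @corner R d M n) x <=
  Rint (fun v => `|partial [:: i] phi v|) + e.
Proof.
move=> sp pM e0; have [n0 H] := riemann_norm (sp [:: i]).1 (pM [:: i]) e0.
exists n0 => n /H{}H.
have [xi xiP] := choice (fun x : grid M n => sample_gradient i x sp pM).
rewrite (eq_bigr (fun x => `|partial [:: i] phi (xi x)|)) => [|x _]; last by have [] := xiP x.
by apply: H => x j; have [] := xiP x.
Qed.

(** Unlike [layers], the bound holds on whole cells and not only at the sampled corners, and the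
    cost is normalised by the cell volume. *)
Definition cell_layers M n k phi (C : R) (c : nat -> grid M n -> R) :=
  [/\ forall m x, 0 <= c m x,
      forall m, block_const (n - m) (c m),
      forall x v, cell x v -> `|phi v| <= \sum_(m < n.+1) c m x &
      (2 ^- n) ^+ d * \sum_x \sum_(m < n.+1) 2 ^+ (m * k) * c m x <= C].

(** Uniform continuity bounds the oscillation on a cell by a constant. It is added to layer 0, whose
    weight is 1, so it costs only itself times the volume of the cube. *)
Lemma layers_to_cells M k phi (e : R) : continuous phi -> supp_in M phi -> 0 < e ->
  exists n0, forall n, (n0 <= n)%N -> forall (C : R) (c : nat -> grid M n -> R),
  layers k (phi \o @corner R d M n) C c ->
  exists c' : nat -> grid M n -> R, cell_layers k phi ((2 ^- n) ^+ d * C + e) c'.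
Proof.
move=> pc pM e0.
have D0 : 0 < ((2 * M)%:R ^+ d + 1 : R) by rewrite ltr_wpDl ?exprn_ge0 ?ler0n.
have e'0 : 0 < e / ((2 * M)%:R ^+ d + 1) by rewrite divr_gt0.
have [r r0 hr] := supp_in_unif pc pM e'0.
have [n0 hn0] := mesh_small r0.
exists n0 => n /hn0 nr C c [c0 cc cf cs].
set e' := e / _ in e'0 hr.
exists (fun m x => c m x + (if m == 0%N then e' else 0)); split => [m x|m x y xy|x v xv|].
- by rewrite addr_ge0//; case: ifP => // _; exact: ltW.
- by rewrite (cc _ _ _ xy).
- have e'E : \sum_(m < n.+1) (if (m : nat) == 0%N then e' else 0) = e'.
    by rewrite big_ord_recl /= big1 ?addr0.
  rewrite big_split /= e'E.
  have := cf x; rewrite /= => cfx.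
  have h : `|phi v - phi (corner R x)| <= e'.
    by apply: hr => j; rewrite (le_lt_trans (cell_dist j xv)).
  have := ler_normD (phi v - phi (corner R x)) (phi (corner R x)).
  by rewrite subrK; move: h cfx; lra.
- under eq_bigr do under eq_bigr do rewrite mulrDr.
  under eq_bigr do rewrite big_split.
  rewrite big_split mulrDr /=; apply: lerD.
    by rewrite ler_wpM2l ?exprn_ge0 ?invr_ge0 ?exprn_ge0.
  rewrite (eq_bigr (fun=> e' * 1)) => [|x _]; last first.
    by rewrite big_ord_recl /= mul0n expr0 mul1r big1 ?addr0 ?mulr1// => m _; rewrite mulr0.
  rewrite -mulr_sumr mulrCA card_grid_mesh /e' mulrAC ler_pdivrMr//.
  by rewrite ler_wpM2l ?(ltW e0)// lerDl.
Qed.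

Definition tuple_count k : R := \sum_(i < k.+1) \sum_(s : i.-tuple 'I_d) 1.

Lemma tuple_count_gt0 k : 0 < tuple_count k.
Proof.
rewrite /tuple_count big_ord_recl ltr_pwDl//; last by rewrite sumr_ge0// => i _; rewrite sumr_ge0.
by rewrite sumr_const card_tuple expn0 mulr1n.
Qed.

Lemma classical_norm_term k phi s : (size s <= k)%N ->
  Rint (fun v => `|partial s phi v|) <= classical_norm k phi.
Proof.
move=> sk; have sk' : (size s < k.+1)%N by [].
rewrite /classical_norm (bigD1 (Ordinal sk'))//= (bigD1 (in_tuple s))//= -addrA lerDl.
rewrite addr_ge0// sumr_ge0// => i _; first exact: Rintegral_ge0.
by apply: sumr_ge0 => t _; exact: Rintegral_ge0.
Qed.

Lemma classical_norm_le k phi (B : R) :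
  (forall s, (size s <= k)%N -> Rint (fun v => `|partial s phi v|) <= B) ->
  classical_norm k phi <= tuple_count k * B.
Proof.
move=> H; rewrite /classical_norm /tuple_count mulr_suml; apply: ler_sum => i _.
rewrite mulr_suml; apply: ler_sum => s _; rewrite mul1r; apply: H.
by rewrite size_tuple -ltnS.
Qed.

Lemma classical_norm_partial k phi i :
  classical_norm k (partial [:: i] phi) <= tuple_count k * classical_norm k.+1 phi.
Proof.
apply: classical_norm_le => s sk; rewrite partial_cat; apply: classical_norm_term.
by rewrite size_cat addn1.
Qed.

Lemma finite_uniform (P : 'I_d -> nat -> Prop) :
  (forall i, exists n0, forall n, (n0 <= n)%N -> P i n) ->
  exists n0, forall n, (n0 <= n)%N -> forall i, P i n.
Proof.
move=> /choice[n0 hn0]; exists (\max_i n0 i) => n nn i; apply: hn0.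
by apply: leq_trans nn; exact: leq_bigmax.
Qed.

(** Induction on the order: [layers_base] for order 1, then [layers_step] with the layers that the
    induction hypothesis gives for each first partial derivative. *)
Lemma cell_layers_exist k : exists2 C : R, 0 < C & forall M phi (e : R),
  smooth phi -> all_supp_in M phi -> 0 < e ->
  exists n0, forall n, (n0 <= n)%N ->
  exists c : nat -> grid M n -> R, cell_layers k.+1 phi (C * classical_norm k.+1 phi + e) c.
Proof.
elim: k => [|k [C C0 IH]].
  pose A : R := (2 ^ d.+3)%:R.
  have A0 : 0 < A by rewrite ltr0n expn_gt0.
  exists (A * (1 + d%:R)); first by rewrite mulr_gt0// ltr_pwDl// ler0n.
  move=> M phi e sp pM e0; have pc := smooth_continuous sp.
  (* One half of [e] is left for [layers_to_cells]; the other covers the [1 + d] sampling errors,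
     multiplied by [A]. *)
  pose e' := e / 2 / (A * (1 + d%:R)).
  have e'0 : 0 < e' by rewrite !divr_gt0// mulr_gt0// ltr_pwDl// ler0n.
  have [n1 h1] := sample_norm pc (pM [::]) e'0.
  have [n2 h2] := finite_uniform (fun i => sample_gradient_norm i sp pM e'0).
  have [n3 h3] := layers_to_cells 1 pc (pM [::]) (divr_gt0 e0 (ltr0n R 2)).
  exists (maxn n1 (maxn n2 n3)) => n; rewrite !geq_max => /and3P[/h1{}h1 /h2{}h2 /h3{}h3].
  have [c /h3[c' [c0 cc cf cs]]] := layers_base (phi \o @corner R d M n).
  exists c'; split => //; apply: le_trans cs _.
  have N1 : Rint (fun v => `|phi v|) <= classical_norm 1 phi by exact: (@classical_norm_term 1 phi [::]).
  have N2 i : Rint (fun v => `|partial [:: i] phi v|) <= classical_norm 1 phi.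
    exact: (@classical_norm_term 1 phi [:: i]).
  set N := classical_norm 1 phi in N1 N2 *.
  have -> : (2 ^- n) ^+ d * ((2 ^ d.+3)%:R * (\sum_(x : grid M n) `|(phi \o @corner R d M n) x| +
      \sum_(x : grid M n) \sum_(i < d) 2 ^+ n * diff i (phi \o @corner R d M n) x)) =
    A * ((2 ^- n) ^+ d * (\sum_(x : grid M n) `|phi (corner R x)|) +
      \sum_(i < d) (2 ^- n) ^+ d * (\sum_(x : grid M n) 2 ^+ n * diff i (phi \o @corner R d M n) x)).
    rewrite mulrCA -[in RHS]mulr_sumr -[in RHS]mulrDr.
    by congr (_ * (_ * (_ + _))); exact: exchange_big.
  have S : (2 ^- n) ^+ d * (\sum_(x : grid M n) `|phi (corner R x)|) +
      \sum_(i < d) (2 ^- n) ^+ d * (\sum_(x : grid M n) 2 ^+ n * diff i (phi \o @corner R d M n) x)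
      <= (1 + d%:R) * (N + e').
    rewrite mulrDl mul1r; apply: lerD; first by apply: le_trans h1 _; rewrite lerD2r.
    rewrite (_ : d%:R * _ = \sum_(i < d) (N + e')); last by rewrite sumr_const card_ord mulr_natl.
    by apply: ler_sum => i _; apply: le_trans (h2 i) _; rewrite lerD2r.
  rewrite [X in _ <= _ + X](splitr e) addrA lerD2r.
  apply: le_trans (ler_wpM2l (ltW A0) S) _; rewrite mulrA mulrDr lerD2l.
  by rewrite /e' mulrC mulfVK// gt_eqF// mulr_gt0// ltr_pwDl// ler0n.
pose D : R := 3 * (2 ^ d)%:R.
have D0 : 0 < D by rewrite mulr_gt0// ltr0n expn_gt0.
pose T := tuple_count k.+1.
have T0 : 0 < T := tuple_count_gt0 _.
exists (1 + D * d%:R * (C * T)).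
  by rewrite ltr_pwDl// mulr_ge0 ?mulr_ge0 ?(ltW D0) ?(ltW C0) ?(ltW T0).
move=> M phi e sp pM e0; have pc := smooth_continuous sp.
have Dd0 : 0 < 1 + D * d%:R by rewrite ltr_pwDl// mulr_ge0// ltW.
(* Here one half covers the sampling error of [phi] and the [d] errors from the induction
   hypothesis, the latter multiplied by [D]. *)
pose e' := e / 2 / (1 + D * d%:R).
have e'0 : 0 < e' by rewrite !divr_gt0.
have [n1 h1] := sample_norm pc (pM [::]) e'0.
have [n2 h2] := finite_uniform (fun i => IH M (partial [:: i] phi) e'
  (smooth_partial [:: i] sp) (all_supp_partial [:: i] pM) e'0).
have [n3 h3] := layers_to_cells k.+2 pc (pM [::]) (divr_gt0 e0 (ltr0n R 2)).
exists (maxn n1 (maxn n2 n3)) => n; rewrite !geq_max => /and3P[/h1{}h1 /h2{}h2 /h3{}h3].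
have [ci ciP] := choice h2.
pose G j x := \sum_i ci i j x.
have [|||c] := @layers_step R d (2 * M) n k.+1 (phi \o @corner R d M n) G (ltn0Sn k) _ _ _.
- by move=> j x; apply: sumr_ge0 => i _; have [] := ciP i.
- by move=> j x y xy; apply: eq_bigr => i _; have [_ cc _ _] := ciP i; exact: cc.
(* The difference quotient is a partial derivative at a point of the same cell, and [cell_layers]
   bounds it there because it covers whole cells. *)
- move=> x; rewrite /G exchange_big /=; apply: ler_sum => i _.
  have [xi [_ xxi ->]] := sample_gradient i x sp pM.
  by have [_ _ cf _] := ciP i; exact: cf.
move=> /h3[c' [c0 cc cf cs]].
exists c'; split => //; apply: le_trans cs _.
set N := classical_norm k.+2 phi.
have N1 : Rint (fun v => `|phi v|) <= N by exact: (@classical_norm_term k.+2 phi [::]).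
have N2 i : classical_norm k.+1 (partial [:: i] phi) <= T * N by exact: classical_norm_partial.
rewrite [X in _ <= _ + X](splitr e) addrA lerD2r.
have S2 : (2 ^- n) ^+ d * (\sum_x \sum_(j < n.+1) 2 ^+ (j * k.+1) * G j x) <= d%:R * (C * T * N + e').
  have -> : \sum_x \sum_(j < n.+1) 2 ^+ (j * k.+1) * G j x =
     \sum_i \sum_x \sum_(j < n.+1) 2 ^+ (j * k.+1) * ci i j x.
    rewrite [RHS]exchange_big /=; apply: eq_bigr => x _; rewrite [RHS]exchange_big /=.
    by apply: eq_bigr => j _; rewrite mulr_sumr.
  rewrite mulr_sumr (_ : d%:R * _ = \sum_(i < d) (C * T * N + e')); last first.
    by rewrite sumr_const card_ord mulr_natl.
  apply: ler_sum => i _; have [_ _ _ ccost] := ciP i; apply: le_trans ccost _.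
  by rewrite lerD2r -mulrA ler_wpM2l ?(ltW C0).
rewrite mulrDr; apply: (@le_trans _ _ ((N + e') + D * (d%:R * (C * T * N + e')))).
  apply: lerD; first by apply: le_trans h1 _; rewrite lerD2r.
  by rewrite mulrCA ler_wpM2l ?(ltW D0).
have -> : e / 2 = (1 + D * d%:R) * e' by rewrite /e' [RHS]mulrC mulfVK// gt_eqF.
by rewrite le_eqVlt; apply/orP; left; apply/eqP; ring.
Qed.

End sampling_norms.

(** * Layers and bumps combined into the capacitary inequality *)

Theorem theorem1p2 (R : realType) (d k : nat) (hd : (1 <= d)%N) (hk : (1 <= k)%N) :
  exists C' : R, 0 < C' /\
    forall phi : 'rV[R]_d -> R, test_function phi ->
      (choquet_integral k phi <= C'%:E * sobolev_norm k phi)%E.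
Proof.
case: k hk => [//|k] _.
have [C C0 HC] := cell_layers_exist R d k.
have [B B0 HB] := @bump_cube R d k.+1 hd.
pose T := tuple_count R d k.+1.
have T0 : 0 < T := tuple_count_gt0 _ _ _.
(* [B] comes from the norms of the bumps, [C] from the cost of the layers, and [T] from comparing
   [classical_norm] with [sobolev_norm]. *)
exists (B * (C * T)); split; first by rewrite !mulr_gt0.
move=> phi tp; have [M pM] := test_supp_in tp.
have Sfin : sobolev_norm k.+1 phi \is a fin_num.
  rewrite ge0_fin_numE ?sobolev_norm_ge0//.
  exact: le_lt_trans (sobolev_norm_le k.+1 tp) (ltry _).
pose S := fine (sobolev_norm k.+1 phi).
have SE : sobolev_norm k.+1 phi = S%:E by rewrite fineK.
have clS : classical_norm k.+1 phi <= T * S.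
  by apply: classical_norm_le => s sk; rewrite -lee_fin -SE; exact: Rint_partial_le.
rewrite SE -EFinM; apply/lee_addgt0Pr => e e0.
(* A single fine grid suffices for each [e]; its error is divided by [B] because the bumps multiply
   the cost of the layers by [B]. *)
have [n0 /(_ n0 (leqnn _)) [c [c0 cc cf cs]]] := HC M phi (e / B) tp.1 pM (divr_gt0 e0 B0).
apply: le_trans (choquet_le_layers c0 cc (ltW B0) HB cf _) _.
  move=> v nx; apply: (pM [::]); apply: contra_notP nx => /forallNP h.
  by apply: cell_ex => j; rewrite ltNge; apply/negP; exact: h.
rewrite -EFinD lee_fin; apply: le_trans (ler_wpM2l (ltW B0) cs) _.
rewrite mulrDr; apply: lerD.
  by rewrite -!mulrA !ler_wpM2l// ltW.
by rewrite mulrC divfK// gt_eqF.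
Qed.
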